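(* Work in $\mathrm{ZF}^-$. (a) $\mathrm{ZF}^-$ proves that exactly one of the following five conjunctions holds, and (b) each of them is consistent with $\mathrm{ZF}^-$: 1. $V=W=HW=V_\infty$, AR, $\mathrm{AR}^W$, $\mathrm{AR}^{HW}$; 2. $V\ne W$, $W\ne HW$, $HW=V_\infty$, $\neg$AR, $\mathrm{AR}^W$, $\mathrm{AR}^{HW}$; 3. $V\ne W$, $W\ne HW$, $HW=V_\infty$, $\neg$AR, $\neg\mathrm{AR}^W$, $\mathrm{AR}^{HW}$; 4. $V=W=HW$, $HW\ne V_\infty$, $\neg$AR, $\neg\mathrm{AR}^W$, $\neg\mathrm{AR}^{HW}$; 5. $V\ne W$, $W\ne HW$, $HW\ne V_\infty$, $\neg$AR, $\neg\mathrm{AR}^W$, $\neg\mathrm{AR}^{HW}$. That is, these are exactly the consistent relationships between $V$, $W$, $HW$, $V_\infty$ and the relativizations of AR to them.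
   Context: $\mathrm{ZF}^-$ denotes Zermelo–Fraenkel set theory without the Axiom of Regularity (AR) and without Choice; $V$ is the universe of sets. For a set $x$, consider the game: player I chooses $x_0\in x$, then II chooses $x_1\in x_0$, then I chooses $x_2\in x_1$, etc.; a player who cannot move (current set empty) loses and its adversary wins. A set is winning if one of the players has a winning strategy in the game from it; $W$ is the class of winning sets. $HW=\{x:\mathrm{tc}(\{x\})\subseteq W\}$ ($\mathrm{tc}$ = transitive closure). $V_\infty=\bigcup_{\alpha\in On}V_\alpha$ is the class of well-founded sets (cumulative hierarchy $V_0=\emptyset$, $V_{\alpha+1}=\mathcal P(V_\alpha)$, unions at limits). For a class $C$, $\mathrm{AR}^C$ denotes the Axiom of Regularity relativized to $C$.
   Formalization: As choice is unavailable, ''winning strategy'' is read as a quasi-strategy (several moves may be allowed) whose set of compatible positions is well-founded (in place of ''no infinite play''); with single-valued strategies the claim fails in some models of ZF without choice. Under choice the notions agree. *)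

(* Defs.v *)
From mathcomp Require Import ssreflect ssrfun ssrbool eqtype ssrnat seq.

(** * First-order logic with equality over the signature {∈} *)

(* De Bruijn syntax: variable [n] refers to the n-th enclosing quantifier
   (0 is the innermost); variables are the only terms. *)
Inductive form : Type :=
| Bot : form
| Elem : nat -> nat -> form
| Eq  : nat -> nat -> form
| Imp : form -> form -> form
| All : form -> form.

Definition Neg A := Imp A Bot.
Definition And A B := Neg (Imp A (Neg B)).
Definition Or A B := Imp (Neg A) B.
Definition Iff A B := And (Imp A B) (Imp B A).
Definition Ex A := Neg (All (Neg A)).

Declare Scope fo_scope.
Delimit Scope fo_scope with fo.
Bind Scope fo_scope with form.

Notation "⊥" := Bot : fo_scope.
Notation "x ∈ y" := (Elem x y) (at level 70, no associativity) : fo_scope.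
Notation "x ≡ y" := (Eq x y) (at level 70, no associativity) : fo_scope.
Notation "¬ A" := (Neg A) (at level 75, right associativity) : fo_scope.
Notation "A ∧ B" := (And A B) (at level 80, right associativity) : fo_scope.
Notation "A ∨ B" := (Or A B) (at level 85, right associativity) : fo_scope.
Notation "A ⟶ B" := (Imp A B) (at level 91, right associativity) : fo_scope.
Notation "A ⟷ B" := (Iff A B) (at level 95, no associativity) : fo_scope.
Notation "∀ A" := (All A) (at level 200, right associativity) : fo_scope.
Notation "∃ A" := (Ex A) (at level 200, right associativity) : fo_scope.
Local Open Scope fo_scope.

Definition up (r : nat -> nat) (n : nat) : nat :=
  if n is m.+1 then (r m).+1 else 0.

Fixpoint rename (r : nat -> nat) (A : form) : form :=
  match A with
  | Bot => Bot
  | Elem x y => Elem (r x) (r y)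
  | Eq x y => Eq (r x) (r y)
  | Imp B C => Imp (rename r B) (rename r C)
  | All B => All (rename (up r) B)
  end.

Definition inst (t : nat) (A : form) : form :=
  rename (fun n => if n is m.+1 then m else t) A.

(* All free variables of [A] are strictly below [fv_bound A]. *)
Fixpoint fv_bound (A : form) : nat :=
  match A with
  | Bot => 0
  | Elem x y | Eq x y => (maxn x y).+1
  | Imp B C => maxn (fv_bound B) (fv_bound C)
  | All B => (fv_bound B).-1
  end.

Definition univ_closure (A : form) : form := iter (fv_bound A) All A.

Definition theory := form -> Prop.

Definition extend (T : theory) (A : form) : theory := fun B => T B \/ B = A.

Definition shift (T : theory) : theory :=
  fun B => exists2 A, T A & B = rename S A.

(* Classical natural deduction. [T] may be infinite, but a derivation, being a
   finite tree, uses only finitely many members of it. *)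
Inductive proves : theory -> form -> Prop :=
| pr_ax T A : T A -> proves T A
| pr_impI T A B : proves (extend T A) B -> proves T (A ⟶ B)
| pr_impE T A B : proves T (A ⟶ B) -> proves T A -> proves T B
| pr_raa T A : proves (extend T (¬ A)) ⊥ -> proves T A
| pr_allI T A : proves (shift T) A -> proves T (All A)
| pr_allE T A t : proves T (All A) -> proves T (inst t A)
| pr_eq_refl T x : proves T (x ≡ x)
| pr_eq_subst T A x y :
    proves T (x ≡ y) -> proves T (inst x A) -> proves T (inst y A).

Definition consistent (T : theory) : Prop := ~ proves T ⊥.

Fixpoint none_of (l : seq form) : form :=
  if l is A :: l' then ¬ A ∧ none_of l' else ¬ ⊥.

Fixpoint exactly_one (l : seq form) : form :=
  if l is A :: l' then (A ∧ none_of l') ∨ (¬ A ∧ exactly_one l') else ⊥.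

(** * Set-theoretic vocabulary

    A definable relation is a function from variables to formulas; its arguments
    are shifted by one under each quantifier. *)

Definition subset x y := ∀ (0 ∈ x.+1 ⟶ 0 ∈ y.+1).
Definition empty x := ∀ ¬ 0 ∈ x.+1.
Definition nonempty x := ∃ 0 ∈ x.+1.
(* z = {a, b} *)
Definition upair z a b := ∀ (0 ∈ z.+1 ⟷ 0 ≡ a.+1 ∨ 0 ≡ b.+1).
(* z = (a, b) = {{a}, {a, b}} *)
Definition opair z a b :=
  ∃ ∃ (upair 1 a.+2 a.+2 ∧ upair 0 a.+2 b.+2 ∧ upair z.+2 1 0).
(* s = x ∪ {x} *)
Definition succ s x := ∀ (0 ∈ s.+1 ⟷ 0 ∈ x.+1 ∨ 0 ≡ x.+1).
(* u = ⋃ x *)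
Definition union u x := ∀ (0 ∈ u.+1 ⟷ ∃ (0 ∈ x.+2 ∧ 1 ∈ 0)).
(* p = 𝒫(x) *)
Definition power p x := ∀ (0 ∈ p.+1 ⟷ subset 0 x.+1).
Definition transitive_set x := ∀ (0 ∈ x.+1 ⟶ subset 0 x.+1).
(* t = tc(x) *)
Definition trans_closure t x :=
  transitive_set t ∧ subset x t ∧
  (∀ (transitive_set 0 ∧ subset x.+1 0 ⟶ subset t.+1 0)).

(* Regularity not being available, well-foundedness is part of the definition. *)
Definition ordinal x :=
  transitive_set x ∧
  (∀ ∀ (1 ∈ x.+2 ∧ 0 ∈ x.+2 ⟶ 1 ∈ 0 ∨ 1 ≡ 0 ∨ 0 ∈ 1)) ∧
  (∀ (subset 0 x.+1 ∧ nonempty 0 ⟶ ∃ (0 ∈ 1 ∧ ¬ (∃ (0 ∈ 2 ∧ 0 ∈ 1))))).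

Definition successor x := ∃ succ x.+1 0.
Definition limit x := ordinal x ∧ nonempty x ∧ ¬ successor x.

(* A natural number is an ordinal n such that every ordinal ≤ n is 0 or a
   successor. *)
Definition natural n :=
  ordinal n ∧ (∀ (0 ∈ n.+1 ∨ 0 ≡ n.+1 ⟶ empty 0 ∨ successor 0)).

(* (x, y) ∈ f *)
Definition maps f x y := ∃ (0 ∈ f.+1 ∧ opair 0 x.+1 y.+1).
(* f is a function with domain d *)
Definition function_on f d :=
  (∀ (0 ∈ f.+1 ⟶ ∃ ∃ (1 ∈ d.+3 ∧ opair 2 1 0))) ∧
  (∀ (0 ∈ d.+1 ⟶ ∃ ∀ (maps f.+3 2 0 ⟷ 0 ≡ 1))).

(** * The axioms of ZF⁻ *)

Definition extensionality := ∀ ∀ ((∀ (0 ∈ 2 ⟷ 0 ∈ 1)) ⟶ 1 ≡ 0).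
Definition pairing := ∀ ∀ ∃ upair 0 2 1.
Definition union_axiom := ∀ ∃ union 0 1.
Definition power_axiom := ∀ ∃ power 0 1.
Definition infinity :=
  ∃ ((∃ (empty 0 ∧ 0 ∈ 1)) ∧ (∀ (0 ∈ 1 ⟶ ∃ (succ 0 1 ∧ 0 ∈ 2)))).

(* ∀a ∃b ∀z (z ∈ b ↔ z ∈ a ∧ A), where in [A] variable 0 is z, variable 1 is a
   and the others are parameters. *)
Definition separation (A : form) :=
  univ_closure (∀ ∃ ∀ (0 ∈ 1 ⟷ 0 ∈ 2 ∧ rename (up S) A)).

(* ∀a (∀x∈a ∀y ∀y' (A(x,y) ∧ A(x,y') → y = y') → ∃b ∀y (y ∈ b ↔ ∃x∈a A(x,y))),
   where in [A] variable 0 is y, variable 1 is x, variable 2 is a and the others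
   are parameters. *)
Definition replacement (A : form) :=
  univ_closure (∀
    ((∀ (0 ∈ 1 ⟶ ∀ ∀ (rename S A ∧ rename (up S) A ⟶ 1 ≡ 0))) ⟶
     ∃ ∀ (0 ∈ 1 ⟷
          ∃ (0 ∈ 3 ∧
             rename (fun n => match n with 0 => 1 | 1 => 0 | m.+2 => m.+3 end)
                    A)))).

Inductive ZFminus : theory :=
| ax_extensionality : ZFminus extensionality
| ax_pairing : ZFminus pairing
| ax_union : ZFminus union_axiom
| ax_power : ZFminus power_axiom
| ax_infinity : ZFminus infinity
| ax_separation A : ZFminus (separation A)
| ax_replacement A : ZFminus (replacement A).

(** * Classes *)

(* A parameter-free class [C] is given by the formulas [C x], read x ∈ C, whose
   only free variable is [x]. *)
Definition class := nat -> form.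

Definition class_eq (C D : class) : form := ∀ (C 0 ⟷ D 0).

Fixpoint relativize (C : class) (A : form) : form :=
  match A with
  | Bot => Bot
  | Elem x y => Elem x y
  | Eq x y => Eq x y
  | Imp B D => Imp (relativize C B) (relativize C D)
  | All B => All (C 0 ⟶ relativize C B)
  end.

Definition AR : form :=
  ∀ (nonempty 0 ⟶ ∃ (0 ∈ 1 ∧ ¬ (∃ (0 ∈ 2 ∧ 0 ∈ 1)))).

Definition V : class := fun x => x ≡ x.

(** The cumulative hierarchy *)

(* f is a function on the ordinal d with f(0) = ∅, f(c+1) = 𝒫(f(c)) and
   f(b) = ⋃_{c<b} f(c) for limit b. *)
Definition hierarchy f d :=
  function_on f d ∧
  (∀ ∀ (maps f.+2 1 0 ⟶
    (empty 1 ⟶ empty 0) ∧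
    (∀ ∀ (succ 3 1 ∧ maps f.+4 1 0 ⟶ power 2 0)) ∧
    (limit 1 ⟶
      ∀ (0 ∈ 1 ⟷ ∃ ∃ (1 ∈ 4 ∧ maps f.+1.+4 1 0 ∧ 2 ∈ 0))))).

(* a is an ordinal and v = V_a *)
Definition V_stage a v :=
  ordinal a ∧ (∃ ∃ (succ 0 a.+2 ∧ hierarchy 1 0 ∧ maps 1 a.+2 v.+2)).

Definition Vinf : class := fun x => ∃ ∃ (V_stage 1 0 ∧ x.+2 ∈ 0).

(** The game *)

(* s is a position of the game from x after n moves: the sequence of length n+1
   with s(0) = x and s(i+1) ∈ s(i); the i-th chosen set is s(i+1). *)
Definition position x s n :=
  natural n ∧
  (∃ (succ 0 n.+1 ∧ function_on s.+1 0)) ∧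
  (∃ (empty 0 ∧ maps s.+1 0 x.+1)) ∧
  (∀ ∀ ∀ ∀ (succ 2 3 ∧ maps s.+4 3 1 ∧ maps s.+4 2 0 ⟶ 0 ∈ 1)).

Definition initial_position x s := ∃ (empty 0 ∧ position x.+1 s.+1 0).

(* s' arises from the position s by one legal move. *)
Definition move x s s' :=
  ∃ ∃ (position x.+2 s.+2 1 ∧ succ 0 1 ∧ position x.+2 s'.+2 0 ∧
       subset s.+2 s'.+2).

(* A winning strategy is given by the set of positions that are compatible with
   it, split into those (p) where its owner is to move and those (q) where the
   opponent is.  In the former the strategy allows at least one legal move, in
   the latter every legal move is possible, and no play goes on forever; hence
   every play ends in a position where the opponent cannot move.  As choice is
   not available,
   - the strategy may allow several moves (a quasi-strategy); a single-valued
     one may fail to exist even when the game is won, and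
   - the absence of infinite plays is expressed as well-foundedness. *)
Definition winning_strategy x p q :=
  (∀ (0 ∈ p.+1 ∨ 0 ∈ q.+1 ⟶ ∃ position x.+2 1 0)) ∧
  (∀ (0 ∈ p.+1 ⟶ ∃ (move x.+2 1 0 ∧ 0 ∈ q.+2))) ∧
  (∀ (0 ∈ q.+1 ⟶ ∀ (move x.+2 1 0 ⟶ 0 ∈ p.+2))) ∧
  (∀ (nonempty 0 ∧ (∀ (0 ∈ 1 ⟶ 0 ∈ p.+2 ∨ 0 ∈ q.+2)) ⟶
      ∃ (0 ∈ 1 ∧ ¬ (∃ (0 ∈ 2 ∧ move x.+3 1 0))))).

Definition I_wins : class := fun x =>
  ∃ ∃ (winning_strategy x.+2 1 0 ∧ (∃ (initial_position x.+3 0 ∧ 0 ∈ 2))).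
Definition II_wins : class := fun x =>
  ∃ ∃ (winning_strategy x.+2 1 0 ∧ (∃ (initial_position x.+3 0 ∧ 0 ∈ 1))).

Definition W : class := fun x => I_wins x ∨ II_wins x.

(* tc({x}) ⊆ W *)
Definition HW : class := fun x =>
  ∃ ∃ (upair 1 x.+2 x.+2 ∧ trans_closure 0 1 ∧ (∀ (0 ∈ 1 ⟶ W 0))).

(** * The five cases *)

Definition case1 : form :=
  class_eq V W ∧ class_eq W HW ∧ class_eq HW Vinf ∧
  AR ∧ relativize W AR ∧ relativize HW AR.
Definition case2 : form :=
  ¬ class_eq V W ∧ ¬ class_eq W HW ∧ class_eq HW Vinf ∧
  ¬ AR ∧ relativize W AR ∧ relativize HW AR.
Definition case3 : form :=
  ¬ class_eq V W ∧ ¬ class_eq W HW ∧ class_eq HW Vinf ∧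
  ¬ AR ∧ ¬ relativize W AR ∧ relativize HW AR.
Definition case4 : form :=
  class_eq V W ∧ class_eq W HW ∧ ¬ class_eq HW Vinf ∧
  ¬ AR ∧ ¬ relativize W AR ∧ ¬ relativize HW AR.
Definition case5 : form :=
  ¬ class_eq V W ∧ ¬ class_eq W HW ∧ ¬ class_eq HW Vinf ∧
  ¬ AR ∧ ¬ relativize W AR ∧ ¬ relativize HW AR.

(* Main.v *)
Require Import Defs.
From Stdlib Require Import Classical ClassicalEpsilon.
From Stdlib Require Import FunctionalExtensionality PropExtensionality.
From mathcomp Require Import ssreflect ssrfun ssrbool eqtype ssrnat seq choice.
Set Implicit Arguments.
Unset Strict Implicit.
Unset Printing Implicit Defensive.

(** By Gödel's completeness theorem, provability in ZF⁻ may be checked in an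
    arbitrary model.  There the winning sets are the two halves of a least fixed
    point: I wins x iff II wins some element of x, II wins x iff I wins every
    element of x.  Choice is not needed to get a strategy out of the fixed point,
    because its stages are well-ordered by inclusion and yield a canonical
    quasi-strategy.  Hence every set of winning sets is winning, and every set of
    hereditarily winning sets is hereditarily winning.  So Vinf ⊆ HW; if HW ≠ Vinf,
    the non-well-founded part of tc({x}), for x ∈ HW not in Vinf, refutes AR in HW
    and in W; and if x ∉ W, then {∅, x} ∈ W \ HW.  This leaves five cases.

    For consistency, well-founded trees up to bisimulation form a model of ZF with
    AR, and permuting the sets, x ∈' y iff x ∈ π(y), gives models of ZF⁻ in which
    the only non-well-founded sets are those built from Ω = {Ω} (case 2), from Ω
    and x = {Ω, ∅, x} (case 3), from x = {∅, x} (case 4), or from Ω and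
    x = {∅, x} (case 5). *)

(** * Tarskian semantics and soundness *)

(** An arbitrary model offers only first-order Separation, Replacement and induction, never their
    versions for all Rocq predicates. Every set formed inside a model therefore carries a
    definability obligation: [Dfn] expresses it for statements of Rocq itself, and [dfn] discharges
    it by reading the statement. The semantic notions copy the shape of the formulas, so that
    [sat_tac] can identify the two by computation. The winning sets form a class, possibly a proper
    one, so the fixed point is built inside tc({x}) only; that it captures all winning strategies
    comes from an upper bound stated for classes ([win_closed]). Its stages are produced without
    recursion along ordinals, in the manner of Bourbaki and Witt, and their comparability supplies
    the order of entry that makes the strategies well-founded. In the consistency models the
    original membership is well-founded from outside, for all Rocq predicates. This permits
    induction along the old membership while the new one is being analysed. *)

Definition scons {X : Type} (a : X) (r : nat -> X) (n : nat) : X :=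
  if n is m.+1 then r m else a.

Fixpoint sat (M : Type) (E : M -> M -> Prop) (r : nat -> M) (A : form) : Prop :=
  match A with
  | Bot => False
  | Elem x y => E (r x) (r y)
  | Eq x y => r x = r y
  | Imp B C => sat E r B -> sat E r C
  | All B => forall m, sat E (scons m r) B
  end.

Lemma sat_fv (M : Type) (E : M -> M -> Prop) A r r' :
  (forall n, n < fv_bound A -> r n = r' n) -> sat E r A <-> sat E r' A.
Proof.
elim: A r r' => [|x y|x y|B IHB C IHC|B IHB] r r' /= e.
- by [].
- by rewrite !e // ltnS ?leq_maxl ?leq_maxr.
- by rewrite !e // ltnS ?leq_maxl ?leq_maxr.
- have [eB eC] : (sat E r B <-> sat E r' B) /\ (sat E r C <-> sat E r' C).
    by split; [apply: IHB|apply: IHC] => n h; apply: e; rewrite leq_max h ?orbT.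
  tauto.
- have eB m : sat E (scons m r) B <-> sat E (scons m r') B.
    by apply: IHB => -[|n] //= h; apply: e; case: (fv_bound B) h.
  by split=> h m; apply/eB.
Qed.

Lemma sat_ext (M : Type) (E : M -> M -> Prop) A r r' :
  r =1 r' -> sat E r A <-> sat E r' A.
Proof. by move=> e; apply: sat_fv. Qed.

Lemma sat_rename (M : Type) (E : M -> M -> Prop) A f r :
  sat E r (rename f A) <-> sat E (fun n => r (f n)) A.
Proof.
elim: A f r => [|x y|x y|B IHB C IHC|B IHB] f r //=.
- by rewrite IHB IHC.
- have eB m : sat E (scons m r) (rename (up f) B) <->
              sat E (scons m (fun n => r (f n))) B.
    by rewrite IHB; apply: sat_ext => -[].
  by split=> h m; apply/eB.
Qed.

Lemma sat_inst (M : Type) (E : M -> M -> Prop) A t r :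
  sat E r (inst t A) <-> sat E (scons (r t) r) A.
Proof. by rewrite sat_rename; apply: sat_ext => -[]. Qed.

Lemma soundness T A : proves T A ->
  forall (M : Type) (E : M -> M -> Prop) r, (forall B, T B -> sat E r B) -> sat E r A.
Proof.
elim=> {T A}.
- by move=> T A TA M E r; apply.
- by move=> T A B _ IH M E r rT rA; apply: IH => C [/rT|->].
- by move=> T A B _ IH1 _ IH2 M E r rT; apply: (IH1 M E r rT); apply: IH2.
- move=> T A _ IH M E r rT; apply: NNPP => nA.
  by apply: (IH M E r) => C [/rT|->].
- move=> T A _ IH M E r rT m; apply: IH => C [D TD ->].
  by rewrite sat_rename; apply: rT.
- by move=> T A t _ IH M E r rT; apply/sat_inst/IH.
- by [].
- move=> T A x y _ IH1 _ IH2 M E r rT; apply/sat_inst.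
  by rewrite -(IH1 M E r rT); apply/sat_inst/IH2.
Qed.

Lemma consistent_of_model (T : theory) (M : Type) (E : M -> M -> Prop) r :
  (forall B, T B -> sat E r B) -> consistent T.
Proof. by move=> h /soundness - /(_ M E r h). Qed.

(** * Completeness *)

Lemma rename_fv A f g :
  (forall n, n < fv_bound A -> f n = g n) -> rename f A = rename g A.
Proof.
elim: A f g => [|x y|x y|B IHB C IHC|B IHB] f g //= e.
- by rewrite !e // ltnS ?leq_maxl ?leq_maxr.
- by rewrite !e // ltnS ?leq_maxl ?leq_maxr.
- by rewrite (IHB f g) ?(IHC f g) // => n h; apply: e; rewrite leq_max h ?orbT.
- rewrite (IHB (up f) (up g)) // => -[|n] //= h.
  by rewrite e //; case: (fv_bound B) h.
Qed.

Lemma rename_ext A f g : f =1 g -> rename f A = rename g A.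
Proof. by move=> e; apply: rename_fv. Qed.

Lemma rename_comp A f g : rename g (rename f A) = rename (g \o f) A.
Proof.
elim: A f g => [|x y|x y|B IHB C IHC|B IHB] f g //=.
- by rewrite IHB IHC.
- by rewrite IHB; congr All; apply: rename_ext => -[].
Qed.

Lemma rename_id A : rename id A = A.
Proof.
elim: A => [|x y|x y|B IHB C IHC|B IHB] //=; first by rewrite IHB IHC.
by rewrite -[in RHS]IHB; congr All; apply: rename_ext => -[].
Qed.

Definition closed_form A := fv_bound A = 0.

Lemma rename_closed A f : closed_form A -> rename f A = A.
Proof. by move=> c; rewrite -[RHS]rename_id; apply: rename_fv => n; rewrite c. Qed.

Lemma proves_weaken T A : proves T A -> forall T', (forall B, T B -> T' B) -> proves T' A.
Proof.
elim=> {T A}.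
- by move=> T A TA T' s; apply/pr_ax/s.
- move=> T A B _ IH T' s; apply/pr_impI/IH => C [/s|->]; [by left|by right].
- by move=> T A B _ IH1 _ IH2 T' s; apply: pr_impE (IH1 _ s) (IH2 _ s).
- move=> T A _ IH T' s; apply/pr_raa/IH => C [/s|->]; [by left|by right].
- by move=> T A _ IH T' s; apply/pr_allI/IH => C [D /s TD ->]; exists D.
- by move=> T A t _ IH T' s; apply/pr_allE/IH.
- by move=> *; apply: pr_eq_refl.
- by move=> T A x y _ IH1 _ IH2 T' s; apply: pr_eq_subst (IH1 _ s) (IH2 _ s).
Qed.

Lemma rename_inst f t A : rename f (inst t A) = inst (f t) (rename (up f) A).
Proof. by rewrite /inst !rename_comp; apply: rename_ext => -[]. Qed.

Lemma proves_rename T A : proves T A ->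
  forall f, proves (fun B => exists2 C, T C & B = rename f C) (rename f A).
Proof.
elim=> {T A}.
- by move=> T A TA f; apply: pr_ax; exists A.
- move=> T A B _ IH f; apply/pr_impI/(proves_weaken (IH f)) => C [D [TD|->] ->].
    by left; exists D.
  by right.
- by move=> T A B _ IH1 _ IH2 f; apply: pr_impE (IH1 f) (IH2 f).
- move=> T A _ IH f; apply/pr_raa/(proves_weaken (IH f)) => C [D [TD|->] ->].
    by left; exists D.
  by right.
- move=> T A _ IH f; apply/pr_allI/(proves_weaken (IH (up f))) => C [D [B TB ->] ->].
  exists (rename f B); first by exists B.
  by rewrite !rename_comp; apply: rename_ext.
- by move=> T A t _ IH f; rewrite rename_inst; apply/pr_allE/IH.
- by move=> *; apply: pr_eq_refl.
- move=> T A x y _ IH1 _ IH2 f; rewrite rename_inst.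
  by apply: pr_eq_subst (IH1 f) _; rewrite -rename_inst; apply: IH2.
Qed.

(** This is what makes the union of the increasing Henkin stages consistent: a refutation of the
    union already lives at one stage. *)
Lemma proves_finite T A : proves T A ->
  exists2 l : seq form, (forall B, List.In B l -> T B) & proves (fun B => List.In B l) A.
Proof.
have ext_fin (T0 : theory) (A0 : form) (l : seq form) :
    (forall B, List.In B l -> extend T0 A0 B) ->
    exists2 l', (forall B, List.In B l' -> T0 B) &
                forall B, List.In B l -> extend (fun C => List.In C l') A0 B.
  elim: l => [|C l IH] h; first by exists [::].
  case: IH => [B Bl|l' h1 h2]; first by apply: h; right.
  case: (h C (or_introl erefl)) => [TC|eC].
    exists (C :: l') => [B /= [<-|/h1]|B /= [<-|/h2 [?|->]]] //;
      by [left; left|left; right|right].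
  by exists l' => // B /= [<-|/h2]; [right|].
elim=> {T A}.
- by move=> T A TA; exists [:: A] => [B /= [<-|]|] //; apply: pr_ax; left.
- move=> T A B _ [l /ext_fin [l' h1 h2] h]; exists l' => //.
  by apply/pr_impI/(proves_weaken h).
- move=> T A B _ [l1 h1 p1] _ [l2 h2 p2]; exists (l1 ++ l2)%list => [C|].
    by rewrite List.in_app_iff => -[/h1|/h2].
  by apply: pr_impE (proves_weaken p1 _) (proves_weaken p2 _) => C ?;
    rewrite List.in_app_iff; [left|right].
- move=> T A _ [l /ext_fin [l' h1 h2] h]; exists l' => //.
  by apply/pr_raa/(proves_weaken h).
- move=> T A _ [l h1 h].
  have [l' h2 h3] : exists2 l', (forall B, List.In B l' -> T B) &
      forall B, List.In B l -> shift (fun C => List.In C l') B.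
    elim: l h1 {h} => [|C l IH] h; first by exists [::].
    case: IH => [B Bl|l' h1 h2]; first by apply: h; right.
    case: (h C (or_introl erefl)) => D TD eC.
    exists (D :: l') => [B /= [<-|/h1]|B /= [<-|/h2 [F ? ->]]] //.
      by exists D; [left|].
    by exists F; [right|].
  by exists l' => //; apply/pr_allI/(proves_weaken h).
- by move=> T A t _ [l h1 h]; exists l => //; apply: pr_allE.
- by move=> T x; exists [::] => //; apply: pr_eq_refl.
- move=> T A x y _ [l1 h1 p1] _ [l2 h2 p2]; exists (l1 ++ l2)%list => [C|].
    by rewrite List.in_app_iff => -[/h1|/h2].
  by apply: pr_eq_subst (proves_weaken p1 _) (proves_weaken p2 _) => C ?;
    rewrite List.in_app_iff; [left|right].
Qed.

(* The variable [k] plays the role of a fresh constant. *)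
Lemma generalize_fresh (T : theory) B k :
  (forall A, T A -> fv_bound A <= k) -> fv_bound B <= k.+1 ->
  proves T (inst k B) -> proves T (All B).
Proof.
move=> fT fB p; apply: pr_allI.
(* [f] turns the fresh variable [k] into the variable that the new quantifier binds. Below [k] it is
   the shift, so it acts on [T] as [shift] does, and after the substitution of [k] for 0 it restores
   every variable of [B]. *)
pose f n := if n == k then 0 else n.+1.
have -> : B = rename f (inst k B).
  rewrite /inst rename_comp -[LHS]rename_id; apply: rename_fv => -[|n] h /=; rewrite /f.
    by rewrite eqxx.
  by rewrite ltn_eqF // -ltnS; apply: leq_trans fB.
apply: (proves_weaken (proves_rename p f)) => _ [C TC ->]; exists C => //.
apply: rename_fv => n h; rewrite /f ltn_eqF //; apply: leq_trans h (fT _ TC).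
Qed.

(** Finitely branching trees with labels in [nat] are countable, so this encoding yields an
    enumeration of all formulas. *)
Fixpoint form_tree (A : form) : GenTree.tree nat :=
  match A with
  | Bot => GenTree.Node 0 [::]
  | Elem x y => GenTree.Node 1 [:: GenTree.Leaf x; GenTree.Leaf y]
  | Eq x y => GenTree.Node 2 [:: GenTree.Leaf x; GenTree.Leaf y]
  | Imp B C => GenTree.Node 3 [:: form_tree B; form_tree C]
  | All B => GenTree.Node 4 [:: form_tree B]
  end.

Fixpoint tree_form (t : GenTree.tree nat) : form :=
  match t with
  | GenTree.Node 1 [:: GenTree.Leaf x; GenTree.Leaf y] => Elem x y
  | GenTree.Node 2 [:: GenTree.Leaf x; GenTree.Leaf y] => Eq x y
  | GenTree.Node 3 [:: t1; t2] => Imp (tree_form t1) (tree_form t2)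
  | GenTree.Node 4 [:: t1] => All (tree_form t1)
  | _ => Bot
  end.

Lemma form_treeK : cancel form_tree tree_form.
Proof. by elim=> //= [B -> C ->|B ->]. Qed.

Definition nth_form (n : nat) : form :=
  if unpickle n is Some t then tree_form t else Bot.

Lemma nth_form_surj A : exists n, nth_form n = A.
Proof. by exists (pickle (form_tree A)); rewrite /nth_form pickleK form_treeK. Qed.

(** * The Henkin construction over a countable language *)

Section Henkin.
Variable T : theory.
Hypothesis T_closed : forall A, T A -> closed_form A.
Hypothesis T_consistent : consistent T.

Definition with_list (l : seq form) : theory := fun B => T B \/ List.In B l.

Fixpoint fresh (l : seq form) : nat :=
  if l is A :: l' then maxn (fv_bound A) (fresh l') else 0.

Lemma fv_with_list l A : with_list l A -> fv_bound A <= fresh l.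
Proof.
case=> [/T_closed ->//|]; elim: l => //= B l IH [->|/IH h]; first exact: leq_maxl.
by rewrite leq_max h orbT.
Qed.

(** The pattern is the unfolding of [Neg (All B)]. Since variables are the only terms, a variable
    occurring in nothing added so far serves as the witnessing constant. *)
Definition henkin_witness A (k : nat) : seq form :=
  if A is Imp (All B) Bot then [:: Neg (inst k B)] else [::].

(** Every formula comes up at some stage. One that is kept receives its witness at once; one that is
    dropped is refuted by the stage that dropped it. *)
Fixpoint henkin_stage (n : nat) : seq form :=
  if n is m.+1 then
    let l := henkin_stage m in let A := nth_form m in
    if excluded_middle_informative (consistent (with_list (A :: l)))
    then henkin_witness A (fresh (A :: l)) ++ A :: l else l
  else [::].

(** If adding the witness were inconsistent, [inst k B] would be provable with [k] fresh;
    generalizing gives [All B], against [A], which is its negation. *)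
Lemma henkin_witness_consistent l A : consistent (with_list (A :: l)) ->
  consistent (with_list (henkin_witness A (fresh (A :: l)) ++ A :: l)).
Proof.
case: A => // A1 [] //; case: A1 => // B; set A := Imp _ _; set k := fresh _ => c p; apply: c.
have fA : fv_bound A <= k by apply: fv_with_list; right; left.
have pA : proves (with_list (A :: l)) A by apply: pr_ax; right; left.
apply: pr_impE pA _; apply: (@generalize_fresh _ _ k).
- by move=> C; apply: fv_with_list.
- by move: fA; rewrite /= maxn0; case: (fv_bound B).
apply: pr_raa; apply: (proves_weaken p) => C [?|/= [<-|[<-|?]]].
- by left; left.
- by right.
- by left; right; left.
- by left; right; right.
Qed.

Lemma henkin_stage_consistent n : consistent (with_list (henkin_stage n)).
Proof.
elim: n => [|n IH] /=.
  by move=> p; apply: T_consistent; apply: (proves_weaken p) => B [].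
case: excluded_middle_informative => // c; exact: henkin_witness_consistent.
Qed.

Lemma henkin_stage_mono m n B :
  m <= n -> List.In B (henkin_stage m) -> List.In B (henkin_stage n).
Proof.
elim: n => [|n IH]; first by rewrite leqn0 => /eqP ->.
rewrite leq_eqVlt ltnS => /orP [/eqP -> //|mn] Bm.
have /= Bn := IH mn Bm; case: excluded_middle_informative => c //=.
by apply/List.in_app_iff; right; right.
Qed.

Definition henkin : theory := fun B => exists n, with_list (henkin_stage n) B.

Lemma henkin_consistent : consistent henkin.
Proof.
move=> /proves_finite [l h p].
have [n hn] : exists n, forall B, List.In B l -> with_list (henkin_stage n) B.
  elim: l h {p} => [|A l IH] h; first by exists 0.
  case: IH => [B Bl|n hn]; first by apply: h; right.
  case: (h A (or_introl erefl)) => m hm; exists (maxn m n) => B [<-|/hn].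
    by case: hm => [|i]; [left|right; apply: henkin_stage_mono i; apply: leq_maxl].
  by case=> [|i]; [left|right; apply: henkin_stage_mono i; apply: leq_maxr].
exact: (henkin_stage_consistent (proves_weaken p hn)).
Qed.

Lemma henkin_neg A : ~ proves henkin A -> proves henkin (Neg A).
Proof.
move=> nA; have [n en] := nth_form_surj A.
case: (excluded_middle_informative (consistent (with_list (A :: henkin_stage n)))) => c.
  case: nA; apply: pr_ax; exists n.+1; right => /=; rewrite en.
  case: excluded_middle_informative => c1 //=.
  by rewrite List.in_app_iff; right; left.
apply: pr_impI; apply: (proves_weaken (NNPP _ c)) => B [TB|/= [<-|h]].
- by left; exists 0; left.
- by right.
- by left; exists n; right.
Qed.

Lemma henkin_imp A B :
  proves henkin (Imp A B) <-> (proves henkin A -> proves henkin B).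
Proof.
split=> [|h]; first exact: pr_impE.
apply: pr_impI; have wk C : proves henkin C -> proves (extend henkin A) C.
  by move=> p; apply: (proves_weaken p) => D; left.
case: (classic (proves henkin A)) => [/h/wk //|/henkin_neg/wk nA].
apply: pr_raa; apply: (@pr_impE _ A); last by apply: pr_ax; left; right.
by apply: (proves_weaken nA) => D; left.
Qed.

(** Right to left: were [All B] unprovable, its negation would be kept at its stage together with a
    refuted instance. *)
Lemma henkin_all B :
  proves henkin (All B) <-> forall k, proves henkin (inst k B).
Proof.
split=> [p k|h]; first exact: pr_allE.
apply: NNPP => nB; set A := Neg (All B).
have [n en] := nth_form_surj A.
have cA : consistent (with_list (A :: henkin_stage n)).
  move=> p; apply: henkin_consistent; apply: pr_impE (henkin_neg nB).
  apply: pr_impI; apply: (proves_weaken p) => C [TC|/= [<-|h']].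
  - by left; exists 0; left.
  - by right.
  - by left; exists n; right.
set k := fresh (A :: henkin_stage n).
have p : proves henkin (Neg (inst k B)).
  apply: pr_ax; exists n.+1; right => /=; rewrite en.
  case: excluded_middle_informative => c1 //=.
  by left.
by apply: henkin_consistent; apply: pr_impE p (h k).
Qed.

Definition heq x y := proves henkin (Eq x y).

Lemma heq_refl x : heq x x. Proof. exact: pr_eq_refl. Qed.

Lemma heq_sym x y : heq x y -> heq y x.
Proof. by move=> h; apply: (@pr_eq_subst _ (Eq 0 x.+1) x y h); apply: pr_eq_refl. Qed.

Lemma heq_trans x y z : heq x y -> heq y z -> heq x z.
Proof. by move=> h1 h2; apply: (@pr_eq_subst _ (Eq x.+1 0) y z h2). Qed.

(** [sat] interprets [Eq] by equality in Rocq, so provably equal variables have to be identified.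
    The least variable of each class is the canonical representative, which makes a subtype of [nat]
    serve as the quotient. *)
Definition least_equal x n := heq x n /\ forall m, m < n -> ~ heq x m.

Lemma least_equal_ex x : exists n, least_equal x n.
Proof.
apply: NNPP => no; suff h n : forall m, m < n -> ~ heq x m.
  exact: (h x.+1 x (ltnSn x) (heq_refl x)).
elim: n => // n IH m; rewrite ltnS leq_eqVlt => /orP [/eqP ->|/IH //] hn.
by apply: no; exists n.
Qed.

Definition rep x := sval (constructive_indefinite_description _ (least_equal_ex x)).

Lemma heq_rep x : heq x (rep x).
Proof. by rewrite /rep; case: constructive_indefinite_description => n []. Qed.

Lemma rep_heq x y : heq x y -> rep x = rep y.
Proof.
rewrite /rep; do 2![case: constructive_indefinite_description] => n [yn ln] m [xm lm] h /=.
case: (ltngtP m n) => //.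
- by move/ln; case; apply: heq_trans xm; apply: heq_sym.
- by move/lm; case; apply: heq_trans yn.
Qed.

Definition henkin_dom := {x : nat | rep x = x}.

Definition henkin_elt (x : nat) : henkin_dom :=
  exist _ (rep x) (esym (rep_heq (heq_rep x))).

Definition henkin_mem (a b : henkin_dom) := proves henkin (Elem (sval a) (sval b)).

Lemma henkin_truth A (r : nat -> henkin_dom) :
  sat henkin_mem r A <-> proves henkin (rename (fun n => sval (r n)) A).
Proof.
elim: A r => [|x y|x y|B IHB C IHC|B IHB] r /=.
- by split=> // /henkin_consistent.
- by [].
- split=> [->|h]; first exact: pr_eq_refl.
  move: (rep_heq h); case: (r x) (r y) => a ra [b rb] /=; rewrite ra rb => e.
  by move: ra rb; rewrite e => ra rb; rewrite (eq_irrelevance ra rb).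
- by rewrite IHB IHC -henkin_imp.
- rewrite henkin_all; have e k m : sval m = k ->
      rename (fun n => sval (scons m r n)) B =
      inst k (rename (up (fun n => sval (r n))) B).
    by move=> ek; rewrite /inst rename_comp; apply: rename_ext => -[].
  split=> h k; last by apply/IHB; rewrite (@e (sval k)).
  (* Only representatives belong to the domain; the instance at [rep k] is carried over to [k] by
     their provable equality. *)
  have /IHB := h (henkin_elt k); rewrite (@e (rep k)) //.
  exact: pr_eq_subst (heq_sym (heq_rep k)).
Qed.

Lemma henkin_model (r : nat -> henkin_dom) A : T A -> sat henkin_mem r A.
Proof.
move=> TA; apply/henkin_truth; rewrite rename_closed; last exact: T_closed.
by apply: pr_ax; exists 0; left.
Qed.

End Henkin.

(** Closed axioms are assumed because the construction uses variables as constants: a free variable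
    of [T] would not be fresh. *)
Theorem completeness (T : theory) A :
  (forall B, T B -> closed_form B) -> closed_form A ->
  (forall (M : Type) (E : M -> M -> Prop),
     (forall r B, T B -> sat E r B) -> forall r, sat E r A) ->
  proves T A.
Proof.
move=> cT cA h; apply: NNPP => nA.
have cT' B : extend T (Neg A) B -> closed_form B.
  by case=> [/cT //|->]; rewrite /closed_form /= cA.
have con : consistent (extend T (Neg A)) by move=> p; apply: nA; apply: pr_raa.
pose r (n : nat) := henkin_elt (extend T (Neg A)) n.
have m r' B : extend T (Neg A) B -> sat (@henkin_mem (extend T (Neg A))) r' B.
  exact: henkin_model.
apply: (m r (Neg A)); first by right.
by apply: h => r' B TB; apply: m; left.
Qed.

(** * Models of ZF⁻ and definability with parameters *)

(** Over an empty carrier there are no valuations and [zf_sat] would hold vacuously; [zf_point]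
    excludes this and supplies a default valuation. *)
Record zf_model := ZfModel {
  dom :> Type;
  zf_point : dom;
  mem : dom -> dom -> Prop;
  zf_sat : forall (r : nat -> dom) A, ZFminus A -> sat mem r A }.

Notation "x ∊ y" := (mem x y) (at level 70, no associativity).

Lemma fv_bound_iter_all n A : fv_bound (iter n All A) = fv_bound A - n.
Proof. by elim: n => [|n IH] /=; rewrite ?subn0 // IH subnS. Qed.

Lemma closed_univ_closure A : closed_form (univ_closure A).
Proof. by rewrite /closed_form fv_bound_iter_all subnn. Qed.

Lemma ZFminus_closed A : ZFminus A -> closed_form A.
Proof. by case=> // *; apply: closed_univ_closure. Qed.

Lemma sat_univ_closure (M : Type) (E : M -> M -> Prop) A :
  (forall r, sat E r (univ_closure A)) <-> (forall r, sat E r A).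
Proof.
rewrite /univ_closure; elim: (fv_bound A) => //= n <-; split=> h r; last by move=> m; apply: h.
by have := h (fun i => r i.+1) (r 0); apply: (iffLR (sat_ext _ _ _)) => -[].
Qed.

Section Connectives.
Variables (M : Type) (E : M -> M -> Prop).
Implicit Types (r : nat -> M) (P Q : Prop).

Lemma sat_imp r A B P Q :
  (sat E r A <-> P) -> (sat E r B <-> Q) -> (sat E r (Imp A B) <-> (P -> Q)).
Proof. move=> /= a b; tauto. Qed.

Lemma sat_neg r A P : (sat E r A <-> P) -> (sat E r (Neg A) <-> ~ P).
Proof. move=> /= a; tauto. Qed.

Lemma sat_and r A B P Q :
  (sat E r A <-> P) -> (sat E r B <-> Q) -> (sat E r (And A B) <-> P /\ Q).
Proof. move=> /= a b; tauto. Qed.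

Lemma sat_or r A B P Q :
  (sat E r A <-> P) -> (sat E r B <-> Q) -> (sat E r (Or A B) <-> P \/ Q).
Proof. move=> /= a b; tauto. Qed.

Lemma sat_iff r A B P Q :
  (sat E r A <-> P) -> (sat E r B <-> Q) -> (sat E r (Iff A B) <-> (P <-> Q)).
Proof. move=> /= a b; tauto. Qed.

Lemma sat_all r A (P : M -> Prop) :
  (forall m, sat E (scons m r) A <-> P m) -> (sat E r (All A) <-> forall m, P m).
Proof. by move=> h; split=> /= H m; apply/h. Qed.

Lemma sat_ex r A (P : M -> Prop) :
  (forall m, sat E (scons m r) A <-> P m) -> (sat E r (Ex A) <-> exists m, P m).
Proof.
move=> h; split=> /= [H|[m /h Hm] H]; last exact: (H m).
by apply: NNPP => no; apply: H => m /h Hm; apply: no; exists m.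
Qed.

End Connectives.

Create HintDb sat.

(* Computes the meaning of a formula by recursion on its syntax, stopping at the
   defined relations whose meaning is already in the hint database. *)
Ltac sat_step :=
  lazymatch goal with
  | |- sat _ _ (Neg _) <-> _ => eapply sat_neg
  | |- sat _ _ (And _ _) <-> _ => eapply sat_and
  | |- sat _ _ (Or _ _) <-> _ => eapply sat_or
  | |- sat _ _ (Iff _ _) <-> _ => eapply sat_iff
  | |- sat _ _ (Imp _ _) <-> _ => eapply sat_imp
  | |- sat _ _ (Ex _) <-> _ => eapply sat_ex; intro
  | |- sat _ _ (All _) <-> _ => eapply sat_all; intro
  | |- sat _ _ Bot <-> _ => reflexivity
  | |- sat _ _ (Elem _ _) <-> _ => reflexivity
  | |- sat _ _ (Eq _ _) <-> _ => reflexivity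
  | |- sat _ _ _ <-> _ =>
      eapply iff_trans; [solve [eauto 2 with sat nocore]|cbn [scons]; reflexivity]
  end.
Ltac sat_tac := repeat sat_step.

Section Definability.
Variable M : zf_model.
Implicit Types (P Q : (nat -> M) -> Prop) (t u v : (nat -> M) -> M).

(* Free variables sit at the even places, parameters at the odd ones. *)
Definition merge (r c : nat -> M) (n : nat) := if odd n then c n./2 else r n./2.

(** Definability is a property of the meaning, not of a formula, so closure under connectives can be
    proved once and then driven by the shape of a Rocq statement. The valuation [c] holds the
    parameters. *)
Definition Dfn P := exists A c, forall r, sat (@mem M) (merge r c) A <-> P r.

Lemma Dfn_ext P Q : (forall r, P r <-> Q r) -> Dfn P -> Dfn Q.
Proof. by move=> e [A [c h]]; exists A, c => r; rewrite h. Qed.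

Lemma Dfn_ren f P : Dfn P -> Dfn (fun r => P (fun n => r (f n))).
Proof.
case=> A [c h]; exists (rename (fun n => if odd n then n else (f n./2).*2) A), c => r.
rewrite sat_rename -h; apply: sat_ext => n; rewrite /merge.
by case o: (odd n); rewrite ?o // odd_double doubleK.
Qed.

(** The two parameter lists are interleaved: parameter [k] of [P] becomes parameter [2k], that of
    [Q] becomes [2k+1], and parameter [j] is the variable [2j+1]. *)
Lemma Dfn_imp P Q : Dfn P -> Dfn Q -> Dfn (fun r => P r -> Q r).
Proof.
case=> A [c h] [A' [c' h']].
exists (Imp (rename (fun n => if odd n then (n./2).*2.*2.+1 else n) A)
            (rename (fun n => if odd n then (n./2).*2.+1.*2.+1 else n) A')), (merge c c') => r.
have e1 : sat (@mem M) (merge r (merge c c'))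
    (rename (fun n => if odd n then (n./2).*2.*2.+1 else n) A) <-> P r.
  rewrite sat_rename -h; apply: sat_ext => n; rewrite /merge.
  case o: (odd n); rewrite ?o //= odd_double /= uphalf_double odd_double.
  by rewrite doubleK.
have e2 : sat (@mem M) (merge r (merge c c'))
    (rename (fun n => if odd n then (n./2).*2.+1.*2.+1 else n) A') <-> Q r.
  rewrite sat_rename -h'; apply: sat_ext => n; rewrite /merge.
  case o: (odd n); rewrite ?o //= !odd_double /= uphalf_double /= odd_double /=.
  by rewrite uphalf_double.
exact: sat_imp.
Qed.

(** The quantifier shifts all indices by one and so swaps parities. A parameter moves up by one, the
    free variable [2k+2] of the body is found at [2k+1], and the truncation [0.-1 = 0] keeps the
    bound variable. *)
Lemma Dfn_all (P : (nat -> M) -> M -> Prop) :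
  Dfn (fun r => P (fun n => r n.+1) (r 0)) -> Dfn (fun r => forall x, P r x).
Proof.
case=> A [c h]; exists (All (rename (fun n => if odd n then n.+1 else n.-1) A)), c => r.
apply: sat_all => m; rewrite sat_rename -(h (scons m r)); apply: sat_ext => n.
case: n => [|[|n]] //=; rewrite /merge /= negbK.
by case o: (odd n) => /=; rewrite o.
Qed.

Lemma Dfn_false : Dfn (fun _ => False).
Proof. by exists Bot, (fun=> zf_point M). Qed.

Lemma Dfn_not P : Dfn P -> Dfn (fun r => ~ P r).
Proof. by move=> h; apply: (Dfn_imp h Dfn_false). Qed.

Lemma Dfn_and P Q : Dfn P -> Dfn Q -> Dfn (fun r => P r /\ Q r).
Proof.
move=> hP hQ; apply: Dfn_ext (Dfn_not (Dfn_imp hP (Dfn_not hQ))) => r /=; tauto.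
Qed.

Lemma Dfn_or P Q : Dfn P -> Dfn Q -> Dfn (fun r => P r \/ Q r).
Proof. move=> hP hQ; apply: Dfn_ext (Dfn_imp (Dfn_not hP) hQ) => r /=; tauto. Qed.

Lemma Dfn_iff P Q : Dfn P -> Dfn Q -> Dfn (fun r => P r <-> Q r).
Proof. by move=> hP hQ; apply: Dfn_and; apply: Dfn_imp. Qed.

Lemma Dfn_ex (P : (nat -> M) -> M -> Prop) :
  Dfn (fun r => P (fun n => r n.+1) (r 0)) -> Dfn (fun r => exists x, P r x).
Proof.
move=> h; have h' := @Dfn_all (fun r x => ~ P r x) (Dfn_not h).
apply: Dfn_ext (Dfn_not h') => r; split=> [H|[x Px] H]; last exact: (H x).
by apply: NNPP => no; apply: H => x Px; apply: no; exists x.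
Qed.

(* Terms are the functions with a definable graph. *)
Definition Tm t := Dfn (fun r => r 0 = t (fun n => r n.+1)).

Lemma Tm_var i : Tm (fun r => r i).
Proof. by exists (Eq 0 i.+1.*2), (fun=> zf_point M) => r /=; rewrite /merge /= odd_double /= doubleK. Qed.

Lemma Tm_cst m : Tm (fun=> m).
Proof. by exists (Eq 0 1), (fun=> m). Qed.

Lemma Dfn_subst t (P : (nat -> M) -> M -> Prop) :
  Tm t -> Dfn (fun r => P (fun n => r n.+1) (r 0)) -> Dfn (fun r => P r (t r)).
Proof.
move=> ht hP; apply: Dfn_ext (@Dfn_ex (fun r x => x = t r /\ P r x) (Dfn_and ht hP)) => r.
by split=> [[x [->]]|] //; exists (t r).
Qed.

Lemma Tm_shift t : Tm t -> Tm (fun r => t (fun n => r n.+1)).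
Proof.
by move=> h; apply: (@Dfn_ren (fun n => if n is m.+1 then m.+2 else 0) _ h).
Qed.

Definition Def1 (P : M -> Prop) := Dfn (fun r => P (r 0)).
Definition Def2 (R : M -> M -> Prop) := Dfn (fun r => R (r 0) (r 1)).
Definition Def3 (R : M -> M -> M -> Prop) := Dfn (fun r => R (r 0) (r 1) (r 2)).

Lemma Dfn_app1 (P : M -> Prop) t : Def1 P -> Tm t -> Dfn (fun r => P (t r)).
Proof. by move=> hP ht; apply: (@Dfn_subst t (fun _ => P) ht hP). Qed.

Lemma Dfn_app2 R t u : Def2 R -> Tm t -> Tm u -> Dfn (fun r => R (t r) (u r)).
Proof.
move=> hR ht hu; apply: (@Dfn_subst t (fun r x => R x (u r)) ht).
apply: (@Dfn_subst (fun r => u (fun n => r n.+1)) (fun r x => R (r 0) x)).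
  exact: Tm_shift.
exact: (@Dfn_ren (fun n => if n is 0 then 1 else 0) _ hR).
Qed.

Lemma Dfn_app3 R t u v :
  Def3 R -> Tm t -> Tm u -> Tm v -> Dfn (fun r => R (t r) (u r) (v r)).
Proof.
move=> hR ht hu hv; apply: (@Dfn_subst t (fun r x => R x (u r) (v r)) ht).
apply: (@Dfn_subst (fun r => u (fun n => r n.+1)) (fun r x => R (r 0) x (v (fun n => r n.+1)))).
  exact: Tm_shift.
apply: (@Dfn_subst (fun r => v (fun n => r n.+2)) (fun r x => R (r 1) (r 0) x)).
  exact: (Tm_shift (Tm_shift hv)).
exact: (@Dfn_ren (fun n => match n with 0 => 2 | 1 => 1 | _ => 0 end) _ hR).
Qed.

Lemma Dfn_mem t u : Tm t -> Tm u -> Dfn (fun r => t r ∊ u r).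
Proof.
apply: Dfn_app2; exists (Elem 0 2), (fun=> zf_point M) => r; reflexivity.
Qed.

Lemma Dfn_eq t u : Tm t -> Tm u -> Dfn (fun r => t r = u r).
Proof.
apply: Dfn_app2; exists (Eq 0 2), (fun=> zf_point M) => r; reflexivity.
Qed.

Lemma Tm_app1 (f : M -> M) t : Def2 (fun y x => y = f x) -> Tm t -> Tm (fun r => f (t r)).
Proof.
move=> hf ht; apply: (Dfn_app2 hf (Tm_var 0)); exact: Tm_shift.
Qed.

Lemma Tm_app2 (f : M -> M -> M) t u :
  Def3 (fun z x y => z = f x y) -> Tm t -> Tm u -> Tm (fun r => f (t r) (u r)).
Proof.
move=> hf ht hu; apply: (Dfn_app3 hf (Tm_var 0)); exact: Tm_shift.
Qed.

(** * Basic set theory *)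

Lemma extensional (x y : M) : (forall z, z ∊ x <-> z ∊ y) -> x = y.
Proof.
move=> h; have := zf_sat (fun=> zf_point M) ax_extensionality.
have e : sat (@mem M) (fun=> zf_point M) extensionality <->
  forall x y : M, (forall z, z ∊ x <-> z ∊ y) -> x = y by rewrite /extensionality; sat_tac.
by move/e; apply.
Qed.

Lemma sep (P : M -> Prop) a : Def1 P -> exists b, forall z, z ∊ b <-> z ∊ a /\ P z.
Proof.
(* Index 0 is the element and index 1 the ambient set, hence parameter [k] goes to [k+2]; all free
   variables collapse to the element. *)
case=> A [c hA]; pose B := rename (fun n => if odd n then n./2.+2 else 0) A.
have := (iffLR (sat_univ_closure _ _)) (fun r => zf_sat r (ax_separation B)) c.
have hB z b : sat (@mem M) (scons z (scons b (scons a c))) (rename (up S) B) <-> P z.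
  rewrite !sat_rename -(hA (fun=> z)); apply: sat_ext => n.
  by rewrite /merge; case: odd.
have := @sat_all _ (@mem M) c
  (Ex (All (Iff (Elem 0 1) (And (Elem 0 2) (rename (up S) B))))) _ (fun m => iff_refl _).
move=> /iffLR h /h /(_ a) {}h; move: h.
have -> : sat (@mem M) (scons a c) (Ex (All (Iff (Elem 0 1) (And (Elem 0 2) (rename (up S) B)))))
  <-> exists b, forall z, z ∊ b <-> z ∊ a /\ P z.
  apply: sat_ex => b; apply: sat_all => z; apply: sat_iff; first reflexivity.
  by apply: sat_and; [reflexivity|apply: hB].
by [].
Qed.

Lemma repl (R : M -> M -> Prop) a : Def2 R ->
  (forall x y y', x ∊ a -> R x y -> R x y' -> y = y') ->
  exists b, forall y, y ∊ b <-> exists x, x ∊ a /\ R x y.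
Proof.
case=> A [c hA] fR.
(* Here indices 0, 1, 2 are taken by the value, the argument and the ambient set, hence the offset
   3; the free variable 0 is the argument and every other one the value. *)
pose B := rename (fun n => if odd n then n./2.+3 else if n is 0 then 1 else 0) A.
have := (iffLR (sat_univ_closure _ _)) (fun r => zf_sat r (ax_replacement B)) c.
have hB x y (r : nat -> M) : r 0 = y -> r 1 = x -> (forall n, r n.+3 = c n) ->
    sat (@mem M) r B <-> R x y.
  move=> r0 r1 r3; rewrite sat_rename -(hA (fun n => if n is 0 then x else y)).
  by apply: sat_ext => -[|[|n]] //=; rewrite /merge /=; case: odd => /=.
have h1 : sat (@mem M) (scons a c) (All (Imp (Elem 0 1) (All (All (Imp
   (And (rename S B) (rename (up S) B)) (Eq 1 0)))))) <->
   forall x, x ∊ a -> forall y y', R x y /\ R x y' -> y = y'.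
  apply: sat_all => x; apply: sat_imp; first reflexivity.
  apply: sat_all => y; apply: sat_all => y'; apply: sat_imp; last reflexivity.
  by apply: sat_and; rewrite sat_rename; apply: hB.
have h2 : sat (@mem M) (scons a c) (Ex (All (Iff (Elem 0 1) (Ex (And (Elem 0 3)
   (rename (fun n => match n with 0 => 1 | 1 => 0 | m.+2 => m.+3 end) B)))))) <->
   exists b, forall y, y ∊ b <-> exists x, x ∊ a /\ R x y.
  apply: sat_ex => b; apply: sat_all => y; apply: sat_iff; first reflexivity.
  apply: sat_ex => x; apply: sat_and; first reflexivity.
  by rewrite sat_rename; apply: hB.
move=> H; apply: (iffLR h2); apply: (H a).
by apply: (iffRL h1) => x xa y y' [Ry Ry']; apply: fR xa Ry Ry'.
Qed.

End Definability.

Create HintDb dfn.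

(** Rocq statements are treated as syntax: connectives are matched by their head, defined relations
    and functions are looked up in the base [dfn]. The extra leading argument [?m] in some patterns
    is the model. *)
Ltac dfn_step :=
  cbv beta;
  lazymatch goal with
  | |- Def1 _ => unfold Def1
  | |- Def2 _ => unfold Def2
  | |- Def3 _ => unfold Def3
  | |- Dfn (fun r => False) => apply Dfn_false
  | |- Dfn (fun r => ~ @?P r) => apply (@Dfn_not _ P)
  | |- Dfn (fun r => @?P r /\ @?Q r) => apply (@Dfn_and _ P Q)
  | |- Dfn (fun r => @?P r \/ @?Q r) => apply (@Dfn_or _ P Q)
  | |- Dfn (fun r => @?P r <-> @?Q r) => apply (@Dfn_iff _ P Q)
  | |- Dfn (fun r => exists x, @?P r x) => apply (@Dfn_ex _ P)
  | |- Dfn (fun r => @?P r -> @?Q r) => apply (@Dfn_imp _ P Q)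
  | |- Dfn (fun r => forall x, @?P r x) => apply (@Dfn_all _ P)
  | |- Dfn (fun r => @?t r = @?u r) => apply (@Dfn_eq _ t u)
  | |- Dfn (fun r => @?t r ∊ @?u r) => apply (@Dfn_mem _ t u)
  | |- Tm _ =>
      first [ exact (@Tm_var _ _) | exact (@Tm_cst _ _)
            | lazymatch goal with
              | |- Tm (fun r => ?f ?m (@?t r) (@?u r)) =>
                  apply (@Tm_app2 _ (f m) t u); [solve [eauto 2 with dfn nocore]| | ]
              | |- Tm (fun r => ?f ?m (@?t r)) =>
                  apply (@Tm_app1 _ (f m) t); [solve [eauto 2 with dfn nocore]| ]
              end ]
  | |- Dfn (fun r => ?R ?m (@?t r) (@?u r) (@?v r)) =>
      apply (@Dfn_app3 _ (R m) t u v); [solve [eauto 2 with dfn nocore]| | | ]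
  | |- Dfn (fun r => ?R (@?t r) (@?u r) (@?v r)) =>
      first [ apply (@Dfn_app3 _ R t u v); [solve [eauto 2 with dfn nocore]| | | ]
            | lazymatch goal with
              | |- Dfn (fun r => ?R ?m (@?t r) (@?u r)) =>
                apply (@Dfn_app2 _ (R m) t u); [solve [eauto 2 with dfn nocore]| | ]
              end ]
  | |- Dfn (fun r => ?R (@?t r) (@?u r)) =>
      first [ apply (@Dfn_app2 _ R t u); [solve [eauto 2 with dfn nocore]| | ]
            | lazymatch goal with
              | |- Dfn (fun r => ?R ?m (@?t r)) =>
                apply (@Dfn_app1 _ (R m) t); [solve [eauto 2 with dfn nocore]| ]
              end ]
  | |- Dfn (fun r => ?R (@?t r)) =>
      apply (@Dfn_app1 _ R t); [solve [eauto 2 with dfn nocore]| ]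
  end.
Ltac dfn := repeat dfn_step.

Section BasicSets.
Variable M : zf_model.
Implicit Types x y z a b : M.

Let r0 : nat -> M := fun=> zf_point M.

Definition sub x y := forall z, z ∊ x -> z ∊ y.

Lemma upr_ex a b : exists z, forall w, w ∊ z <-> w = a \/ w = b.
Proof.
have := zf_sat r0 ax_pairing.
have -> : sat (@mem M) r0 pairing <->
  forall a b, exists z, forall w, w ∊ z <-> w = a \/ w = b.
  by rewrite /pairing /upair; sat_tac.
by apply.
Qed.

Definition upr a b := sval (constructive_indefinite_description _ (upr_ex a b)).

Lemma in_upr a b z : z ∊ upr a b <-> z = a \/ z = b.
Proof. by rewrite /upr; case: constructive_indefinite_description. Qed.

Lemma upr_eq z a b : z = upr a b <-> forall w, w ∊ z <-> w = a \/ w = b.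
Proof.
split=> [-> w|h]; first exact: in_upr.
by apply: extensional => w; rewrite h in_upr.
Qed.

Lemma Un_ex x : exists u, forall z, z ∊ u <-> exists y, y ∊ x /\ z ∊ y.
Proof.
have := zf_sat r0 ax_union.
have -> : sat (@mem M) r0 union_axiom <->
  forall x, exists u, forall z, z ∊ u <-> exists y, y ∊ x /\ z ∊ y.
  by rewrite /union_axiom /union; sat_tac.
by apply.
Qed.

Definition Un x := sval (constructive_indefinite_description _ (Un_ex x)).

Lemma in_Un x z : z ∊ Un x <-> exists y, y ∊ x /\ z ∊ y.
Proof. by rewrite /Un; case: constructive_indefinite_description. Qed.

Lemma Un_eq u x : u = Un x <-> forall z, z ∊ u <-> exists y, y ∊ x /\ z ∊ y.
Proof.
split=> [-> w|h]; first exact: in_Un.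
by apply: extensional => w; rewrite h in_Un.
Qed.

Lemma Pw_ex x : exists p, forall z, z ∊ p <-> sub z x.
Proof.
have := zf_sat r0 ax_power.
have -> : sat (@mem M) r0 power_axiom <->
  forall x, exists p, forall z, z ∊ p <-> sub z x.
  by rewrite /power_axiom /power /subset; sat_tac.
by apply.
Qed.

Definition Pw x := sval (constructive_indefinite_description _ (Pw_ex x)).

Lemma in_Pw x z : z ∊ Pw x <-> sub z x.
Proof. by rewrite /Pw; case: constructive_indefinite_description. Qed.

Lemma Pw_eq p x : p = Pw x <-> forall z, z ∊ p <-> sub z x.
Proof.
split=> [-> w|h]; first exact: in_Pw.
by apply: extensional => w; rewrite h in_Pw.
Qed.

Lemma e0_ex : exists e : M, forall z, ~ z ∊ e.
Proof.
have [|b hb] := @sep M (fun=> False) (zf_point M); first exact: Dfn_false.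
by exists b => z /hb [].
Qed.

Definition e0 : M := sval (constructive_indefinite_description _ e0_ex).

Lemma in_e0 z : ~ z ∊ e0.
Proof. by rewrite /e0; case: constructive_indefinite_description. Qed.

Lemma e0_eq x : x = e0 <-> forall z, ~ z ∊ x.
Proof.
split=> [-> z|h]; first exact: in_e0.
by apply: extensional => z; split=> [/h|/in_e0].
Qed.

Lemma ne0_ex x : x <> e0 <-> exists z, z ∊ x.
Proof.
split=> [h|[z zx] e]; last by rewrite e in zx; apply: in_e0 zx.
by apply: NNPP => no; apply: h; apply/e0_eq => z zx; apply: no; exists z.
Qed.

Definition cup a b := Un (upr a b).

Lemma in_cup a b z : z ∊ cup a b <-> z ∊ a \/ z ∊ b.
Proof.
rewrite in_Un; split=> [[y [/in_upr [->|->]]]|[]]; first by left.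
- by right.
- by exists a; split=> //; apply/in_upr; left.
- by exists b; split=> //; apply/in_upr; right.
Qed.

Lemma in_sing a z : z ∊ upr a a <-> z = a.
Proof. rewrite in_upr; tauto. Qed.

Definition sc x := cup x (upr x x).

Lemma in_sc x z : z ∊ sc x <-> z ∊ x \/ z = x.
Proof. by rewrite in_cup in_sing. Qed.

Lemma sc_self x : x ∊ sc x. Proof. by apply/in_sc; right. Qed.

Lemma sc_eq s x : s = sc x <-> forall z, z ∊ s <-> z ∊ x \/ z = x.
Proof.
split=> [-> w|h]; first exact: in_sc.
by apply: extensional => w; rewrite h in_sc.
Qed.

Definition op a b := upr (upr a a) (upr a b).

Lemma op_inj a b a' b' : op a b = op a' b' -> a = a' /\ b = b'.
Proof.
move=> e.
have ea : a = a'.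
  have : upr a a ∊ op a' b' by rewrite -e; apply/in_upr; left.
  case/in_upr => e'; have : a' ∊ upr a a by rewrite e'; apply/in_upr; left.
    by move/in_sing.
  by move/in_sing.
split=> //; rewrite -{a'}ea in e.
have h1 : upr a b ∊ op a b' by rewrite -e; apply/in_upr; right.
have h2 : upr a b' ∊ op a b by rewrite e; apply/in_upr; right.
have h3 : b ∊ upr a b by apply/in_upr; right.
have h4 : b' ∊ upr a b' by apply/in_upr; right.
case/in_upr: h1 => e1; last first.
  by move: h3; rewrite e1 => /in_upr [eb|//]; move: h4; rewrite -e1 eb => /in_sing ->.
move: h3; rewrite e1 => /in_sing ->.
by case/in_upr: h2 => e2; move: h4; rewrite e2 ?e1 => /in_sing ->.
Qed.

Lemma def_upr : Def3 (fun z a b => z = upr a b).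
Proof.
apply: (@Dfn_ext _ (fun r => forall w, w ∊ r 0 <-> w = r 1 \/ w = r 2)); last by dfn.
by move=> r; rewrite upr_eq.
Qed.

Lemma def_Un : Def2 (fun z a => z = Un a).
Proof.
apply: (@Dfn_ext _ (fun r => forall z, z ∊ r 0 <-> exists y, y ∊ r 1 /\ z ∊ y)); last by dfn.
by move=> r; rewrite Un_eq.
Qed.

Lemma def_sub : Def2 sub.
Proof. rewrite /sub; dfn. Qed.

End BasicSets.

Arguments e0 {M}.
#[global] Hint Resolve def_upr def_Un def_sub : dfn.

Section BasicDef.
Variable M : zf_model.

Lemma def_Pw : Def2 (fun z a : M => z = Pw a).
Proof.
apply: (@Dfn_ext _ (fun r => forall z, z ∊ r 0 <-> sub z (r 1))); last by dfn.
by move=> r; rewrite Pw_eq.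
Qed.

Lemma def_cup : Def3 (fun z a b : M => z = cup a b).
Proof. rewrite /cup; dfn. Qed.

Lemma def_sc : Def2 (fun z a : M => z = sc a).
Proof. by rewrite /sc /cup; dfn. Qed.

Lemma def_op : Def3 (fun z a b : M => z = op a b).
Proof. rewrite /op; dfn. Qed.

End BasicDef.
#[global] Hint Resolve def_Pw def_cup def_sc def_op : dfn.

(** * Ordinals *)

Section Ordinals.
Variable M : zf_model.
Implicit Types x y z a b : M.

Definition trans x := forall y, y ∊ x -> sub y x.

Definition has_minimal x := exists m, m ∊ x /\ ~ exists c, c ∊ x /\ c ∊ m.

(** The shape is that of the formula [ordinal], down to conjunctions where curried hypotheses would
    be more usual. [Hier], [Stage], [Nat] and [wstrat] follow their formulas in the same way. *)
Definition Ord x :=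
  trans x /\ (forall a b, a ∊ x /\ b ∊ x -> a ∊ b \/ a = b \/ b ∊ a) /\
  (forall y, sub y x /\ (exists z, z ∊ y) -> has_minimal y).

Lemma Ord_trans x y z : Ord x -> y ∊ x -> z ∊ y -> z ∊ x.
Proof. by move=> [tx _] yx; apply: tx. Qed.

Lemma Ord_irr x : Ord x -> ~ x ∊ x.
Proof.
move=> [_ [_ w]] xx; have [|m [/in_sing -> no]] := w (upr x x).
  by split; [move=> z /in_sing ->|exists x; apply/in_sing].
by apply: no; exists x; split=> //; apply/in_sing.
Qed.

Lemma Ord_no_cycle x a b c : Ord x -> a ∊ x -> b ∊ x -> c ∊ x ->
  a ∊ b -> b ∊ c -> c ∊ a -> False.
Proof.
move=> [_ [_ w]] ax bx cx ab bc ca.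
have h z : z ∊ cup (upr a b) (upr c c) <-> z = a \/ z = b \/ z = c.
  rewrite in_cup in_upr in_sing; tauto.
have [|m [/h hm no]] := w (cup (upr a b) (upr c c)).
  by split=> [z /h [->|[->|->]]|] //; exists a; apply/h; left.
apply: no; case: hm => [->|[->|->]].
- by exists c; split=> //; apply/h; right; right.
- by exists a; split=> //; apply/h; left.
- by exists b; split=> //; apply/h; right; left.
Qed.

Lemma Ord_in x y : Ord x -> y ∊ x -> Ord y.
Proof.
move=> ox yx; have [tx [lx wx]] := ox; have sy := tx _ yx; split; last split.
- move=> z zy w wz; have zx := sy _ zy; have wx' : w ∊ x := tx _ zx _ wz.
  case: (lx w y) => [//|//|[e|yw]].
    exfalso; rewrite e in wz; have [|m [/in_upr hm no]] := wx (upr y z).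
      by split=> [u /in_upr [->|->]|] //; exists y; apply/in_upr; left.
    apply: no; case: hm => ->.
      by exists z; split=> //; apply/in_upr; right.
    by exists y; split=> //; apply/in_upr; left.
  by case: (Ord_no_cycle ox wx' zx yx).
- by move=> a b [ay iy]; apply: lx; split; apply: sy.
- by move=> u [su ne]; apply: wx; split=> // v /su /sy.
Qed.

Lemma Ord_sc x : Ord x -> Ord (sc x).
Proof.
move=> ox; have [tx [lx wx]] := ox; split; last split.
- move=> y /in_sc [yx|->] z zy; apply/in_sc; left=> //; exact: tx zy.
- move=> a b [/in_sc [ax|->] /in_sc [bx|->]].
  + exact: lx.
  + by left.
  + by right; right.
  + by right; left.
- move=> y [sy [z zy]]; have [|b hb] := @sep M (fun w => w ∊ x) y; first by dfn.
  case: (classic (exists w, w ∊ b)) => [ne|no].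
    have [|m [/hb [my mx] no]] := wx b; first by split=> // w /hb [].
    exists m; split=> // -[c [cy cm]]; apply: no; exists c; split=> //; apply/hb.
    by split=> //; apply: tx mx _ cm.
  exists z; split=> // -[c [cy cz]].
  have /in_sc [zx|ez] := sy _ zy; first by apply: no; exists z; apply/hb.
  by apply: no; exists c; apply/hb; rewrite -ez.
Qed.

Lemma def_trans : Def1 trans.
Proof. rewrite /trans; dfn. Qed.

Lemma def_Ord : Def1 Ord.
Proof. by rewrite /Ord /trans /has_minimal; dfn. Qed.

(** The counterexamples in [sc x], which includes [x] itself, form a set; its minimal element
    contradicts the induction step. *)
Lemma Ord_ind (P : M -> Prop) : Def1 P ->
  (forall x, Ord x -> (forall y, y ∊ x -> P y) -> P x) -> forall x, Ord x -> P x.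
Proof.
move=> dP step x ox; apply: NNPP => nP.
have [|b hb] := @sep M (fun w => ~ P w) (sc x); first by dfn.
have [_ [_ w]] := Ord_sc ox; have [|m [/hb [mx nm] no]] := w b.
  by split=> [z /hb []|] //; exists x; apply/hb; split=> //; apply: sc_self.
apply: nm; apply: step => [|y ym]; first exact: Ord_in (Ord_sc ox) mx.
apply: NNPP => ny; apply: no; exists y; split=> //; apply/hb; split=> //.
exact: Ord_trans (Ord_sc ox) mx ym.
Qed.

Lemma Ord_least (P : M -> Prop) x : Def1 P -> Ord x -> P x ->
  exists m, Ord m /\ P m /\ forall y, y ∊ m -> ~ P y.
Proof.
move=> dP ox Px; apply: NNPP => no.
suff : ~ P x by [].
apply: (@Ord_ind (fun z => ~ P z)) ox => [|z oz h Pz]; first by dfn.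
by apply: no; exists z.
Qed.

End Ordinals.
#[global] Hint Resolve def_trans def_Ord : dfn.

Section OrdinalOrder.
Variable M : zf_model.
Implicit Types x y z a b : M.

(** By induction on both: if neither belongs to the other, then each element of one belongs to the
    other, and extensionality makes them equal. *)
Lemma Ord_total a b : Ord a -> Ord b -> a ∊ b \/ a = b \/ b ∊ a.
Proof.
move=> oa; move: a oa b.
apply: Ord_ind => [|a oa IHa b ob]; first by dfn.
move: b ob; apply: Ord_ind => [|b ob IHb]; first by dfn.
apply: NNPP => no; have e : a = b; last tauto.
apply: extensional => c; split=> [ca|cb].
- case: (IHa _ ca b ob) => [//|[e|bc]]; first by subst; tauto.
  by have := Ord_trans oa ca bc; tauto.
- case: (IHb _ cb) => [ac|[e|//]]; last by subst; tauto.
  by have := Ord_trans ob cb ac; tauto.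
Qed.

Lemma Ord_Un (X : M) : (forall a, a ∊ X -> Ord a) -> Ord (Un X).
Proof.
move=> oX; have oU z : z ∊ Un X -> Ord z.
  by move=> /in_Un [a [/oX oa za]]; apply: Ord_in za.
split; last split.
- move=> y /in_Un [a [aX ya]] z zy; apply/in_Un; exists a; split=> //.
  exact: Ord_trans (oX _ aX) ya zy.
- by move=> a b [/oU oa /oU ob]; apply: Ord_total.
- move=> y [sy [z zy]]; apply: NNPP => no.
  have oz := oU _ (sy _ zy).
  have [|m [om [my hm]]] := @Ord_least M (fun w => w ∊ y) z _ oz zy; first by dfn.
  by apply: no; exists m; split=> // -[c [cy /hm]].
Qed.

End OrdinalOrder.

(** * The cumulative hierarchy *)

Section Hierarchy.
Variable M : zf_model.
Implicit Types x y z a b f d v w : M.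

Definition fun_on f d :=
  (forall p, p ∊ f -> exists x y, x ∊ d /\ p = op x y) /\
  (forall x, x ∊ d -> exists y, forall y', op x y' ∊ f <-> y' = y).

Definition Lim b := Ord b /\ (exists z, z ∊ b) /\ ~ exists c, b = sc c.

Definition Hier f d :=
  fun_on f d /\
  forall b v, op b v ∊ f ->
    (b = e0 -> v = e0) /\
    (forall c w, b = sc c /\ op c w ∊ f -> v = Pw w) /\
    (Lim b -> forall z, z ∊ v <-> exists c w, c ∊ b /\ op c w ∊ f /\ z ∊ w).

Definition Stage a v :=
  Ord a /\ exists f d, d = sc a /\ Hier f d /\ op a v ∊ f.

Definition Vi x := exists a v, Stage a v /\ x ∊ v.

Lemma def_fun_on : Def2 fun_on.
Proof. by rewrite /fun_on; dfn. Qed.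

Lemma def_Lim : Def1 Lim.
Proof. by rewrite /Lim; dfn. Qed.

End Hierarchy.
#[global] Hint Resolve def_fun_on def_Lim : dfn.

Lemma def_Hier (M : zf_model) : Def2 (@Hier M).
Proof. by rewrite /Hier; dfn. Qed.
#[global] Hint Resolve def_Hier : dfn.

Lemma def_Stage (M : zf_model) : Def2 (@Stage M).
Proof. by rewrite /Stage; dfn. Qed.
#[global] Hint Resolve def_Stage : dfn.

Lemma def_Vi (M : zf_model) : Def1 (@Vi M).
Proof. by rewrite /Vi; dfn. Qed.
#[global] Hint Resolve def_Vi : dfn.

Section HierarchyTheory.
Variable M : zf_model.
Implicit Types x y z a b c f d g v w : M.

Lemma fun_on_dom f d x y : fun_on f d -> op x y ∊ f -> x ∊ d.
Proof. by move=> [h _] /h [x' [y' [xd /op_inj [-> _]]]]. Qed.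

Lemma fun_on_uniq f d x y y' : fun_on f d -> op x y ∊ f -> op x y' ∊ f -> y = y'.
Proof.
move=> hf h; have [_ hu] := hf; have [v hv] := hu _ (fun_on_dom hf h).
by move: h => /hv -> /hv ->.
Qed.

Lemma fun_on_ex f d x : fun_on f d -> x ∊ d -> exists y, op x y ∊ f.
Proof. by move=> [_ h] /h [y hy]; exists y; apply/hy. Qed.

Lemma fun_on_restrict f d c : fun_on f d -> sub c d ->
  exists g, fun_on g c /\ forall b v, op b v ∊ g <-> op b v ∊ f /\ b ∊ c.
Proof.
move=> hf cd.
have [|g hg] := @sep M (fun p => exists b v, b ∊ c /\ p = op b v) f; first by dfn.
have hg' b v : op b v ∊ g <-> op b v ∊ f /\ b ∊ c.
  rewrite hg; split=> [[bf [b' [v' [bc /op_inj [eb _]]]]]|[bf bc]].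
    by rewrite eb in bf *.
  by split=> //; exists b, v.
exists g; split=> //; split=> [p /hg [_] //|x xc].
have [_ /(_ _ (cd _ xc)) [y hy]] := hf; exists y => y'.
by rewrite hg' hy; split=> [[]|].
Qed.

Lemma Ord_cases b : Ord b -> b = e0 \/ (exists c, b = sc c) \/ Lim b.
Proof.
move=> ob; case: (classic (b = e0)) => [|/ne0_ex ne]; first by left.
by case: (classic (exists c, b = sc c)) => [|no]; right; [left|right].
Qed.

Lemma sc_sub c a : Ord a -> c ∊ sc a -> sub (sc c) (sc a).
Proof.
move=> oa ca z /in_sc [zc|->] //; exact: Ord_trans (Ord_sc oa) ca zc.
Qed.

Lemma Hier_uniq f g a b : Ord a -> Ord b -> Hier f (sc a) -> Hier g (sc b) ->
  forall c, Ord c -> c ∊ sc a -> c ∊ sc b ->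
  forall v w, op c v ∊ f -> op c w ∊ g -> v = w.
Proof.
move=> oa ob [ff hf] [fg hg]; apply: Ord_ind => [|c oc IH ca cb v w cv cw]; first by dfn.
have la x : x ∊ c -> x ∊ sc a by apply: Ord_trans (Ord_sc oa) ca.
have lb x : x ∊ c -> x ∊ sc b by apply: Ord_trans (Ord_sc ob) cb.
have [f0 [fs fl]] := hf _ _ cv; have [g0 [gs gl]] := hg _ _ cw.
case: (Ord_cases oc) => [e|[[d e]|l]].
- by rewrite f0 // g0.
- have dc : d ∊ c by rewrite e; apply: sc_self.
  have [v' hv'] := fun_on_ex ff (la _ dc).
  have [w' hw'] := fun_on_ex fg (lb _ dc).
  rewrite (fs d v') // (gs d w') //.
  by rewrite (IH d dc (la _ dc) (lb _ dc) v' w').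
- apply: extensional => z; rewrite fl // gl //.
  split=> -[d [u [dc [du zu]]]].
    have [u' hu'] := fun_on_ex fg (lb _ dc); exists d, u'.
    by have e := IH d dc (la _ dc) (lb _ dc) u u' du hu'; subst u'.
  have [u' hu'] := fun_on_ex ff (la _ dc); exists d, u'.
  by have e := IH d dc (la _ dc) (lb _ dc) u' u hu' du; subst u'.
Qed.

Lemma Stage_Ord a v : Stage a v -> Ord a. Proof. by case. Qed.

Lemma Stage_uniq a v w : Stage a v -> Stage a w -> v = w.
Proof.
move=> [oa [f [_ [-> [hf av]]]]] [_ [g [_ [-> [hg aw]]]]].
by apply: (Hier_uniq oa oa hf hg oa) av aw; apply: sc_self.
Qed.

(** Cutting [f] down to [sc c] leaves a hierarchy that witnesses [Stage c]; the converse is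
    uniqueness of stages. *)
Lemma Hier_Stage f a c v : Ord a -> Hier f (sc a) -> c ∊ sc a ->
  op c v ∊ f <-> Stage c v.
Proof.
move=> oa hf ca; have oc := Ord_in (Ord_sc oa) ca.
suff h u : op c u ∊ f -> Stage c u.
  split=> [/h //|s]; have [u cu] := fun_on_ex (proj1 hf) ca.
  by rewrite (Stage_uniq s (h _ cu)).
move=> cu; split=> //; have [ff' hh] := hf.
have [g [fg hg]] := fun_on_restrict ff' (sc_sub oa ca).
exists g, (sc c); split=> //; split; last by apply/hg; split=> //; apply: sc_self.
split=> // b w /hg [bw bc]; have [h0 [hs hl]] := hh _ _ bw; split=> //; split.
- by move=> d u' [e /hg [du _]]; apply: hs (conj e du).
- move=> l z; rewrite hl //; split=> -[d [u' [db [du zu]]]]; exists d, u'; split=> //.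
    by rewrite hg; split=> //; split=> //; apply: Ord_trans (Ord_sc oc) bc db.
  by case/hg: du.
Qed.

Lemma Stage_rec b v : Stage b v ->
  (b = e0 -> v = e0) /\
  (forall c w, b = sc c -> Stage c w -> v = Pw w) /\
  (Lim b -> forall z, z ∊ v <-> exists c w, c ∊ b /\ Stage c w /\ z ∊ w).
Proof.
move=> [ob [f [_ [-> [hf bv]]]]]; have [ff hh] := hf.
have [h0 [hs hl]] := hh _ _ bv; split=> //; split.
- move=> c w e sw; apply: (hs c w); split=> //.
  by apply/(Hier_Stage _ ob hf) => //; apply/in_sc; left; rewrite e; apply: sc_self.
- move=> l z; rewrite hl //; split=> -[c [w [cb [cw zw]]]]; exists c, w; split=> //;
    split=> //; move: cw; apply (Hier_Stage _ ob hf); by apply/in_sc; left.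
Qed.

(** Replacement collects the earlier stages ([X]) and their graph ([G]). The value [v0] demanded at
    [a] depends on whether [a] is zero, a successor or a limit, and the graph extended by the pair
    of [a] and [v0] is the required hierarchy. *)
Lemma Stage_ex a : Ord a -> exists v, Stage a v.
Proof.
move: a; apply: Ord_ind => [|a oa IH]; first by dfn.
have [||G hG] := @repl M (fun b p => exists v, Stage b v /\ p = op b v) a; first by dfn.
  by move=> b p p' _ [v [sv ->]] [v' [sv' ->]]; rewrite (Stage_uniq sv sv').
have [||X hX] := @repl M (fun b v => Stage b v) a; first by dfn.
  by move=> b v v' _; apply: Stage_uniq.
have [v0 [h0 [hs hl]]] : exists v,
  (a = e0 -> v = e0) /\
  (forall c w, a = sc c -> Stage c w -> v = Pw w) /\
  (Lim a -> forall z, z ∊ v <-> exists c w, c ∊ a /\ Stage c w /\ z ∊ w).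
  case: (Ord_cases oa) => [e|[[c e]|l]].
  - exists e0; split=> //; split=> [c w e'|[_ [/ne0_ex //]]].
    by have := sc_self c; rewrite -e' e => /in_e0.
  - have ca : c ∊ a by rewrite e; apply: sc_self.
    have [w sw] := IH c ca; exists (Pw w); split; last split.
    + by move=> e'; move: ca; rewrite e' => /in_e0.
    + move=> c' w' e' sw'; suff ec : c = c' by subst c'; rewrite (Stage_uniq sw sw').
      have /in_sc [h|//] : c ∊ sc c' by rewrite -e'.
      have /in_sc [h'|//] : c' ∊ sc c by rewrite -e e'; apply: sc_self.
      by case: (Ord_irr (Ord_in oa ca)); apply: Ord_trans (Ord_in oa ca) h' h.
    + by case=> _ [_ no]; case: no; exists c.
  - exists (Un X); split; last split.
    + by move=> e; case: l => _ [[z]]; rewrite e => /in_e0.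
    + by move=> c w e; case: l => _ [_]; case; exists c.
    + move=> _ z; rewrite in_Un; split=> [[v [/hX [b [ba sv]] zv]]|[c [w [ca [sw zw]]]]].
        by exists b, v.
      by exists w; split=> //; apply/hX; exists c.
exists v0; split=> //; set f := cup G (upr (op a v0) (op a v0)).
have hf b v : op b v ∊ f <-> (b ∊ a /\ Stage b v) \/ (b = a /\ v = v0).
  rewrite in_cup in_sing hG; split=> [[[c [ca [w [sw /op_inj [-> ->]]]]]|/op_inj]|]; try by [left|right].
  by case=> [[ba sv]|[-> ->]]; [left; exists b; split=> //; exists v|right].
exists f, (sc a); split=> //; split; last by apply/hf; right.
split.
- split=> [p /in_cup [/hG [b [ba [v [_ ->]]]]|/in_sing ->]|x /in_sc [xa|->]].
  + by exists b, v; split=> //; apply/in_sc; left.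
  + by exists a, v0; split=> //; apply: sc_self.
  + have [v sv] := IH _ xa; exists v => y; rewrite hf; split=> [[[_ sy]|[e _]]|->].
    * exact: Stage_uniq sy sv.
    * by case: (Ord_irr oa); rewrite -{1}e.
    * by left.
  + exists v0 => y; rewrite hf; split=> [[[aa _]|[]]|->] //; last by right.
    by case: (Ord_irr oa).
- have low b c : c ∊ b -> (b ∊ a \/ b = a) -> forall w, op c w ∊ f <-> Stage c w.
    move=> cb hb w; have ca : c ∊ a by case: hb => [ba|<-] //; apply: Ord_trans oa ba cb.
    rewrite hf; split=> [[[]|[e _]]|] //; last by left.
    by case: (Ord_irr oa); rewrite -{1}e.
  move=> b v bv; have hb : b ∊ a \/ b = a by case/hf: bv => -[]; [left|right].
  have [k0 [ks kl]] : (b = e0 -> v = e0) /\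
    (forall c w, b = sc c -> Stage c w -> v = Pw w) /\
    (Lim b -> forall z, z ∊ v <-> exists c w, c ∊ b /\ Stage c w /\ z ∊ w).
    by case/hf: bv => [[_ /Stage_rec //]|[-> ->]].
  split=> //; split=> [c w [e cw]|l z].
    by apply: (ks c) => //; apply/(low b) => //; rewrite e; apply: sc_self.
  rewrite kl //; split=> -[c [w [cb [cw zw]]]]; exists c, w; split=> //; split=> //;
    by apply/(low b).
Qed.

(** The one equation V_a = ⋃_{b<a} 𝒫(V_b) replaces the three recursion clauses in everything that
    follows. *)
Lemma in_Stage a v z : Stage a v ->
  z ∊ v <-> exists b w, b ∊ a /\ Stage b w /\ sub z w.
Proof.
move=> sv; have oa := Stage_Ord sv; move: a oa v sv z.
apply: Ord_ind => [|a oa IH v sv z]; first by dfn.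
have [h0 [hs hl]] := Stage_rec sv; case: (Ord_cases oa) => [e|[[c e]|l]].
- rewrite h0 // e; by split=> [/in_e0|[b [w [/in_e0]]]].
- have ca : c ∊ a by rewrite e; apply: sc_self.
  have [w sw] := Stage_ex (Ord_in oa ca); rewrite (hs c w) // in_Pw.
  split=> [zw|[b [u [ba [su zu]]]]]; first by exists c, w.
  move: (ba); rewrite e => /in_sc [bc|eb]; last by subst b; rewrite (Stage_uniq sw su).
  move=> t /zu /(IH b ba _ su) [d [s [db [ss ts]]]]; apply/(IH c ca _ sw).
  by exists d, s; split=> //; apply: Ord_trans (Ord_in oa ca) bc db.
- rewrite hl //; split=> [[b [w [ba [sw zw]]]]|[b [w [ba [sw zw]]]]].
    move/(IH b ba _ sw): zw => [d [s [db [ss ts]]]]; exists d, s; split=> //.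
    exact: Ord_trans oa ba db.
  have ob := Ord_in oa ba; have [u su] := Stage_ex (Ord_sc ob).
  exists (sc b), u; split; last first.
    split=> //; have [_ [h _]] := Stage_rec su.
    by rewrite (h b w) // in_Pw.
  case: (Ord_total (Ord_sc ob) oa) => [//|[eb|/in_sc ab]].
    by case: l => _ [_]; case; exists b.
  case: (Ord_irr ob); case: ab => [ab|eb]; first exact: Ord_trans ob ab ba.
  by rewrite -{2}eb.
Qed.

Lemma Stage_mono a v b w : Stage a v -> Stage b w -> sub a b -> sub v w.
Proof.
move=> sv sw ab z /(in_Stage _ sv) [c [u [ca [su zu]]]].
by apply/(in_Stage _ sw); exists c, u; split=> //; apply: ab.
Qed.

Lemma Vi_trans x y : Vi x -> y ∊ x -> Vi y.
Proof.
move=> [a [v [sv /(in_Stage _ sv) [b [w [ba [sw xw]]]]]]] yx.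
by exists b, w; split=> //; apply: xw.
Qed.

(** Replacement needs one value per element, so each element is sent to the least ordinal whose
    stage contains it. All elements then lie in the stage at the union of these ordinals, and [x] in
    the next one. *)
Lemma Vi_closed x : (forall z, z ∊ x -> Vi z) -> Vi x.
Proof.
move=> hx.
pose R z a := (exists v, Stage a v /\ z ∊ v) /\
              forall b, b ∊ a -> ~ exists v, Stage b v /\ z ∊ v.
have [||X hX] := @repl M R x; first by rewrite /R; dfn.
  move=> z a b _ [ha la] [hb lb].
  have oa : Ord a by case: ha => v [/Stage_Ord].
  have ob : Ord b by case: hb => v [/Stage_Ord].
  by case: (Ord_total oa ob) => [/lb|[|/la]].
have oX a : a ∊ X -> Ord a by move=> /hX [z [_ [[v [/Stage_Ord]]]]].
have oU := Ord_Un oX; have [v sv] := Stage_ex oU.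
have [u su] := Stage_ex (Ord_sc oU); exists (sc (Un X)), u; split=> //.
apply/(in_Stage _ su); exists (Un X), v; split; first exact: sc_self.
split=> // z zx; have [a [w [sw zw]]] := hx _ zx.
have [|m [om [[t [st zt]] lm]]] := @Ord_least M (fun a => exists v, Stage a v /\ z ∊ v) a
    _ (Stage_Ord sw) (ex_intro _ w (conj sw zw)); first by dfn.
apply: (Stage_mono st sv _ zt) => y ym; apply/in_Un; exists m; split=> //; apply/hX.
by exists z; split=> //; split=> //; exists t.
Qed.

(** An element of [y] lying in the earliest possible stage is minimal, since its own elements lie in
    still earlier stages. *)
Lemma Vi_minimal x y : x ∊ y -> Vi x -> has_minimal y.
Proof.
move=> xy [a [v [sv xv]]].
have [|m [om [[t [z [st [zy zt]]]] lm]]] := @Ord_least M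
  (fun a => exists v z, Stage a v /\ z ∊ y /\ z ∊ v) a _ (Stage_Ord sv)
  (ex_intro _ v (ex_intro _ x (conj sv (conj xy xv)))); first by dfn.
exists z; split=> // -[c [cy cz]].
move: zt => /(in_Stage _ st) [b [w [bm [sw zw]]]].
by apply: (lm b bm); exists w, c; split=> //; split=> //; apply: zw.
Qed.

End HierarchyTheory.

(** * Natural numbers *)

Section Naturals.
Variable M : zf_model.
Implicit Types x y z a b n m : M.

Definition Nat n :=
  Ord n /\ forall m, m ∊ n \/ m = n -> m = e0 \/ exists c, m = sc c.

Lemma def_Nat : Def1 Nat.
Proof. by rewrite /Nat; dfn. Qed.

Lemma Nat_Ord n : Nat n -> Ord n. Proof. by case. Qed.

Lemma Ord_e0 : Ord (@e0 M).
Proof.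
split; first by move=> y /in_e0.
split; first by move=> a b [/in_e0].
by move=> y [sy [z /sy /in_e0]].
Qed.

Lemma Nat_e0 : Nat e0.
Proof.
by split=> [|m [/in_e0 //|->]]; [apply: Ord_e0|left].
Qed.

Lemma Nat_in n m : Nat n -> m ∊ n -> Nat m.
Proof.
move=> [on hn] mn; split; first exact: Ord_in mn.
by move=> k [km|->]; apply: hn; left=> //; apply: Ord_trans mn km.
Qed.

Lemma Nat_sc n : Nat n -> Nat (sc n).
Proof.
move=> [on hn]; split; first exact: Ord_sc.
by move=> m [/in_sc //|->]; [apply: hn|right; exists n].
Qed.

Lemma sc_inj a b : Ord a -> sc a = sc b -> a = b.
Proof.
move=> oa e; have /in_sc [ab|//] : a ∊ sc b by rewrite -e; apply: sc_self.
have /in_sc [ba|//] : b ∊ sc a by rewrite e; apply: sc_self.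
by case: (Ord_irr oa); apply: Ord_trans oa ba ab.
Qed.

Lemma Nat_ind (P : M -> Prop) : Def1 P -> P e0 ->
  (forall n, Nat n -> P n -> P (sc n)) -> forall n, Nat n -> P n.
Proof.
move=> dP P0 PS n nn; have on := Nat_Ord nn; move: n on nn.
apply: Ord_ind => [|n on IH nn]; first by have dN := def_Nat; dfn.
have [_ /(_ n (or_intror erefl)) [->//|[c e]]] := nn.
have cn : c ∊ n by rewrite e; apply: sc_self.
have nc := Nat_in nn cn; rewrite e; apply: PS => //; exact: IH.
Qed.

(** The axiom gives some inductive set only; ω is separated from it, and induction shows that no
    natural number is missing. *)
Lemma omega_ex : exists w : M, forall n, n ∊ w <-> Nat n.
Proof.
have := zf_sat (fun=> zf_point M) ax_infinity.
have -> : sat (@mem M) (fun=> zf_point M) infinity <->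
  exists I : M, (exists e, (forall z, ~ z ∊ e) /\ e ∊ I) /\
            (forall x, x ∊ I -> exists y, (forall z, z ∊ y <-> z ∊ x \/ z = x) /\ y ∊ I).
  by rewrite /infinity /empty /succ; sat_tac.
case=> I [[e [/e0_eq -> I0] IS]].
have dN := def_Nat.
have [|w hw] := @sep M (fun n => Nat n) I; first by dfn.
exists w => n; rewrite hw; split=> [[]//|nn]; split=> //.
move: n nn; apply: Nat_ind => [|//|n nn nI]; first by dfn.
by have [y [/sc_eq <-]] := IS _ nI.
Qed.

End Naturals.
#[global] Hint Resolve def_Nat : dfn.

(** * Positions of the game and transitive closures *)

Section Positions.
Variable M : zf_model.
Implicit Types x y z a b n m i s t u v w p q : M.

Definition pos x s n :=
  Nat n /\ fun_on s (sc n) /\ op e0 x ∊ s /\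
  forall i u v, op i u ∊ s -> op (sc i) v ∊ s -> v ∊ u.

Lemma def_pos : Def3 pos.
Proof. by rewrite /pos; dfn. Qed.

Lemma e0_in_sc n : Nat n -> e0 ∊ sc n.
Proof.
move: n; apply: Nat_ind => [||n _ h]; first by dfn.
  exact: sc_self.
by apply/in_sc; left.
Qed.

Lemma pos_len x s n m : pos x s n -> pos x s m -> n = m.
Proof.
move=> [nn [fn _]] [nm [fm _]]; apply: sc_inj; first exact: Nat_Ord.
apply: extensional => z; split=> [/(fun_on_ex fn) [y]|/(fun_on_ex fm) [y]].
  exact: fun_on_dom.
exact: fun_on_dom.
Qed.

Lemma pos_last x s n : pos x s n -> exists z, op n z ∊ s.
Proof. by move=> [_ [f _]]; apply: fun_on_ex f (sc_self _). Qed.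

Lemma pos_uniq x s n i u v : pos x s n -> op i u ∊ s -> op i v ∊ s -> u = v.
Proof. by move=> [_ [f _]]; apply: fun_on_uniq f. Qed.

Lemma pos_start x : pos x (upr (op e0 x) (op e0 x)) e0.
Proof.
have h i u : op i u ∊ upr (op e0 x) (op e0 x) <-> i = e0 /\ u = x.
  by rewrite in_sing; split=> [/op_inj|[-> ->]].
split; first exact: Nat_e0.
split; last split; last 1 first.
- by move=> i u v /h [-> _] /h [/e0_eq /(_ e0)]; case; apply: sc_self.
- split=> [p /in_sing ->|y /in_sc [/in_e0//|->]].
    by exists e0, x; split=> //; apply: sc_self.
  by exists x => y'; rewrite h; split=> [[]|].
- by apply/h.
Qed.

Lemma pos_e0_last x s z : pos x s e0 -> op e0 z ∊ s -> z = x.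
Proof. by move=> hp h; have [_ [_ [h0 _]]] := hp; apply: pos_uniq hp h h0. Qed.

Lemma pos_extend x s n z v : pos x s n -> op n z ∊ s -> v ∊ z ->
  exists s', pos x s' (sc n) /\ sub s s' /\ op (sc n) v ∊ s'.
Proof.
move=> [nn [f [h0 hs]]] nz vz; have oS := Ord_sc (Nat_Ord nn).
set s' := cup s (upr (op (sc n) v) (op (sc n) v)).
have h i u : op i u ∊ s' <-> op i u ∊ s \/ (i = sc n /\ u = v).
  rewrite in_cup in_sing; split=> [[|/op_inj]|[|[-> ->]]]; by [left|right].
have nS u : ~ op (sc n) u ∊ s by move=> /(fun_on_dom f) /(Ord_irr oS).
exists s'; split; last by split=> [p ps|]; [apply/in_cup; left|apply/h; right].
split; first exact: Nat_sc.
split; last split; last 1 first.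
- move=> i u w /h [iu|[-> ->]] /h [iw|[e ->]].
  + exact: hs iu iw.
  + have {}e : n = i by apply: sc_inj (esym e); apply: Nat_Ord.
    by subst i; rewrite (fun_on_uniq f iu nz).
  + have /(Ord_trans oS) := fun_on_dom f iw; move/(_ (sc n) (sc_self _)).
    by move/(Ord_irr oS).
  + by case: (Ord_irr oS); rewrite -{2}e; apply: sc_self.
- split=> [p /in_cup [ps|/in_sing ->]|i /in_sc [id|->]].
  + have [f1 _] := f; have [i [u [id ->]]] := f1 _ ps.
    by exists i, u; split=> //; apply/in_sc; left.
  + by exists (sc n), v; split=> //; apply: sc_self.
  + have [_ /(_ _ id) [y hy]] := f; exists y => y'; rewrite h hy.
    split=> [[//|[e _]]|->]; last by left.
    by case: (Ord_irr oS); rewrite -{1}e.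
  + by exists v => y'; rewrite h; split=> [[/nS|[]]|->] //; right.
- by apply/h; left.
Qed.

Lemma pos_restrict x s n i : pos x s n -> i ∊ sc n ->
  exists s', pos x s' i /\ forall b v, op b v ∊ s' <-> op b v ∊ s /\ b ∊ sc i.
Proof.
move=> [nn [f [h0 hs]]] hi; have ni := Nat_in (Nat_sc nn) hi.
have [s' [f' h]] := fun_on_restrict f (sc_sub (Nat_Ord nn) hi).
exists s'; split=> //; split=> //; split=> //; split.
  by apply/h; split=> //; apply: e0_in_sc.
by move=> j u v /h [ju _] /h [jv _]; apply: hs ju jv.
Qed.

Lemma pos_pred x s n v : pos x s (sc n) -> op (sc n) v ∊ s -> Nat n ->
  exists s' z, pos x s' n /\ op n z ∊ s' /\ v ∊ z.
Proof.
move=> hp hv nn.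
have ns : n ∊ sc (sc n) by apply/in_sc; left; apply: sc_self.
have [s' [hp' h]] := pos_restrict hp ns; have [z nz] := pos_last hp'.
exists s', z; split=> //; split=> //.
by have [_ [_ [_ hs]]] := hp; case/h: nz => nz _; apply: hs nz hv.
Qed.

(** This describes tc({x}) rather than tc(x): [x] itself has to be an element of [t]. *)
Definition is_tc t x :=
  trans t /\ x ∊ t /\ forall T, trans T -> x ∊ T -> sub t T.

Hint Resolve def_pos : dfn.

(** The sets reachable in [n] moves form a set, the next level being the union of the previous one.
    Levels are unique, so Replacement over ω collects them. *)
Lemma reach_ex x : exists t, forall z, z ∊ t <-> exists n s, pos x s n /\ op n z ∊ s.
Proof.
have step n : Nat n -> exists F, forall z, z ∊ F <-> exists s, pos x s n /\ op n z ∊ s.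
  move: n; apply: Nat_ind => [||n nn [F hF]]; first by dfn.
    exists (upr x x) => z; rewrite in_sing; split=> [->|[s [hp]]].
      by exists (upr (op e0 x) (op e0 x)); split; [apply: pos_start|apply/in_sing].
    exact: pos_e0_last.
  exists (Un F) => z; rewrite in_Un; split=> [[u [/hF [s [hp nu]] zu]]|[s [hp nz]]].
    by have [s' [hp' [_ ?]]] := pos_extend hp nu zu; exists s'.
  have [s' [u [hp' [nu zu]]]] := pos_pred hp nz nn.
  by exists u; split=> //; apply/hF; exists s'.
have [w hw] := omega_ex M.
have [||X hX] := @repl M (fun n F => forall z, z ∊ F <-> exists s, pos x s n /\ op n z ∊ s) w.
- by dfn.
- by move=> n F F' _ h h'; apply: extensional => z; rewrite h h'.
exists (Un X) => z; rewrite in_Un; split=> [[F [/hX [n [/hw nn hF]] /hF [s hs]]]|[n [s [hp nz]]]].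
  by exists n, s.
have nn : Nat n by case: hp.
have [F hF] := step _ nn; exists F; split; last by apply/hF; exists s.
by apply/hX; exists n; split=> //; apply/hw.
Qed.

(** Positions are the finite descending membership paths from [x], so the game itself provides the
    transitive closure. *)
Lemma tc_reach x t : is_tc t x <->
  forall z, z ∊ t <-> exists n s, pos x s n /\ op n z ∊ s.
Proof.
have low T z : trans T -> x ∊ T -> (exists n s, pos x s n /\ op n z ∊ s) -> z ∊ T.
  move=> tT xT [n [s [hp nz]]]; have nn : Nat n by case: hp.
  move: n nn z s hp nz; apply: Nat_ind => [||n nn IH] ; first by dfn.
    by move=> z s hp /(pos_e0_last hp) ->.
  move=> z s hp nz; have [s' [u [hp' [nu zu]]]] := pos_pred hp nz nn.
  exact: tT (IH _ _ hp' nu) _ zu.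
have high t' : (forall z, z ∊ t' <-> exists n s, pos x s n /\ op n z ∊ s) -> is_tc t' x.
  move=> h; split; last split.
  - move=> u /h [n [s [hp nu]]] z zu; apply/h.
    by have [s' [hp' [_ ?]]] := pos_extend hp nu zu; exists (sc n), s'.
  - apply/h; exists e0, (upr (op e0 x) (op e0 x)).
    by split; [apply: pos_start|apply/in_sing].
  - by move=> T tT xT z /h /(low T z tT xT).
split=> [[tt [xt mt]] z|]; last exact: high.
split=> [zt|/(low t z tt xt) //].
have [t' ht'] := reach_ex x; have [tt' [xt' _]] := high _ ht'.
by apply/ht'; apply: mt zt.
Qed.

Lemma tc_ex x : exists t, is_tc t x.
Proof. by have [t ht] := reach_ex x; exists t; apply/tc_reach. Qed.

Lemma positions_ex x : exists S, forall s n, pos x s n -> s ∊ S.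
Proof.
have [t ht] := reach_ex x; have [w hw] := omega_ex M.
(* A pair over [c] is an element of 𝒫(𝒫(c)), and a position is a set of such pairs. *)
set c := cup w t; exists (Pw (Pw (Pw c))) => s n hp; apply/in_Pw => p ps.
have [nn [[f1 f2] _]] := hp; have [i [u [hi e]]] := f1 _ ps; subst p.
have ic : i ∊ c by apply/in_cup; left; apply/hw; apply: Nat_in (Nat_sc nn) hi.
have uc : u ∊ c.
  apply/in_cup; right; apply/ht; have [s' [hp' h]] := pos_restrict hp hi.
  by exists i, s'; split=> //; apply/h; split=> //; apply: sc_self.
by apply/in_Pw => y /in_upr [->|->]; apply/in_Pw => z /in_upr [->|->].
Qed.

Definition mv x s s' := exists n, pos x s n /\ pos x s' (sc n) /\ sub s s'.

Lemma mv_last x s s' n z : mv x s s' -> pos x s n -> op n z ∊ s ->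
  pos x s' (sc n) /\ sub s s' /\ exists v, op (sc n) v ∊ s' /\ v ∊ z.
Proof.
move=> [m [hm [hm' ss']]] hn nz; have e := pos_len hm hn; subst m.
split=> //; split=> //; have [v hv] := pos_last hm'; exists v; split=> //.
by have [_ [_ [_ hs]]] := hm'; apply: hs (ss' _ nz) hv.
Qed.

Definition wstrat x p q :=
  (forall s, s ∊ p \/ s ∊ q -> exists n, pos x s n) /\
  (forall s, s ∊ p -> exists s', mv x s s' /\ s' ∊ q) /\
  (forall s, s ∊ q -> forall s', mv x s s' -> s' ∊ p) /\
  (forall b, (exists s, s ∊ b) /\ (forall s, s ∊ b -> s ∊ p \/ s ∊ q) ->
     exists s, s ∊ b /\ ~ exists s', s' ∊ b /\ mv x s s').

Definition Iw x := exists p q, wstrat x p q /\ exists s, pos x s e0 /\ s ∊ p.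
Definition IIw x := exists p q, wstrat x p q /\ exists s, pos x s e0 /\ s ∊ q.
Definition Wi x := Iw x \/ IIw x.

End Positions.
#[global] Hint Resolve def_pos : dfn.

Lemma def_mv (M : zf_model) : Def3 (@mv M).
Proof. by rewrite /mv; dfn. Qed.
#[global] Hint Resolve def_mv : dfn.

Lemma def_wstrat (M : zf_model) : Def3 (@wstrat M).
Proof. by rewrite /wstrat; dfn. Qed.
#[global] Hint Resolve def_wstrat : dfn.

Lemma def_Wi (M : zf_model) : Def1 (@Wi M).
Proof. by rewrite /Wi /Iw /IIw; dfn. Qed.
#[global] Hint Resolve def_Wi : dfn.

(** * Winning sets as a least fixed point *)

Section Winning.
Variable M : zf_model.
Implicit Types x y z a b n m i s t u v w p q C : M.

(** A position violating one of the two conclusions always has a successor violating the other: the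
    owner's allowed move leads to a bad position, and the opponent can move to one. A nonempty set
    of bad positions would thus contradict the absence of infinite plays. *)
Lemma wstrat_closed x p q (C : M -> Prop) : Def1 C ->
  (forall z, (exists u, u ∊ z /\ forall v, v ∊ u -> C v) -> C z) ->
  wstrat x p q ->
  (forall s n z, s ∊ p -> pos x s n -> op n z ∊ s -> C z) /\
  (forall s n z, s ∊ q -> pos x s n -> op n z ∊ s -> forall v, v ∊ z -> C v).
Proof.
move=> dC cC [h1 [h2 [h3 h4]]].
pose bad s := (s ∊ p /\ exists n z, pos x s n /\ op n z ∊ s /\ ~ C z) \/
  (s ∊ q /\ exists n z, pos x s n /\ op n z ∊ s /\ exists v, v ∊ z /\ ~ C v).
have [|b hb] := @sep M bad (cup p q); first by rewrite /bad; dfn.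
have {}hb s : s ∊ b <-> bad s.
  rewrite hb; split=> [[]//|hs]; split=> //; apply/in_cup; rewrite /bad in hs; tauto.
suff no s : ~ bad s.
  split=> s n z hs hp nz => [|v vz]; apply: NNPP => nC; apply: (no s).
    by left; split=> //; exists n, z.
  by right; split=> //; exists n, z; split=> //; split=> //; exists v.
move=> hs; have [|{hs}s [/hb hs nos]] := h4 b.
  by split=> [|u /hb]; [exists s; apply/hb|rewrite /bad; tauto].
apply: nos; case: hs => -[sp [n [z [hp [nz hz]]]]].
  have [s' [ms' s'q]] := h2 _ sp; have [hp' [ss' [u [nu uz]]]] := mv_last ms' hp nz.
  exists s'; split=> //; apply/hb; right; split=> //; exists (sc n), u.
  split=> //; split=> //; apply: NNPP => no; apply: hz; apply: cC.
  by exists u; split=> // v vu; apply: NNPP => nv; apply: no; exists v.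
have [v [vz nv]] := hz; have [s' [hp' [ss' nv']]] := pos_extend hp nz vz.
have ms' : mv x s s' by exists n.
exists s'; split=> //; apply/hb; left; split; first exact: h3 ms'.
by exists (sc n), v.
Qed.

Lemma win_closed x (C : M -> Prop) : Def1 C ->
  (forall z, (exists u, u ∊ z /\ forall v, v ∊ u -> C v) -> C z) ->
  (Iw x -> C x) /\ (IIw x -> forall v, v ∊ x -> C v).
Proof.
move=> dC cC; split=> -[p [q [/(wstrat_closed dC cC) [hP hQ] [s [hp sp]]]]].
  by apply: (hP _ _ _ sp hp); case: hp => _ [_ []].
by apply: (hQ _ _ _ sp hp); case: hp => _ [_ []].
Qed.

(** A recipe [R] that depends only on the current set yields a strategy made of the positions that
    have obeyed [R] at every step ([steps]). Only sets [B] of sets then have to be examined for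
    well-foundedness, not sets of positions. *)
Lemma strategy_of_graph x P Q (R : M -> M -> Prop) : Def2 R ->
  (forall z, z ∊ P -> exists u, u ∊ z /\ u ∊ Q /\ R z u) ->
  (forall z, z ∊ Q -> forall v, v ∊ z -> v ∊ P /\ R z v) ->
  (forall B, (exists z, z ∊ B) -> (forall z, z ∊ B -> z ∊ P \/ z ∊ Q) ->
     exists z, z ∊ B /\ ~ exists u, u ∊ B /\ u ∊ z /\ R z u) ->
  (x ∊ P -> Iw x) /\ (x ∊ Q -> IIw x).
Proof.
move=> dR hP hQ wf; have [S hS] := positions_ex x.
pose steps s := forall i u v, op i u ∊ s -> op (sc i) v ∊ s -> R u v.
have steps_mv s s' n z v : pos x s n -> op n z ∊ s -> pos x s' (sc n) -> sub s s' ->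
    op (sc n) v ∊ s' -> R z v -> steps s -> steps s'.
  move=> hp nz hp' ss' nv zv hs i u w iu iw.
  have [nn [f _]] := hp; have [_ [f' _]] := hp'.
  have hi := fun_on_dom f' iw; have [hi'|e] : sc i ∊ sc n \/ sc i = sc n.
    by apply/in_sc.
    have ii : i ∊ sc n by apply: Ord_trans (Ord_sc (Nat_Ord nn)) hi' (sc_self _).
    have [u' iu'] := fun_on_ex f ii; have [w' iw'] := fun_on_ex f hi'.
    rewrite (pos_uniq hp' iu (ss' _ iu')) (pos_uniq hp' iw (ss' _ iw')).
    exact: hs iu' iw'.
  have ei : n = i by apply: sc_inj (esym e); apply: Nat_Ord.
  subst i; rewrite (pos_uniq hp' iu (ss' _ nz)) (pos_uniq hp' iw nv) //.
have dsteps : Def1 steps by rewrite /steps; dfn.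
have [|p hp] := @sep M (fun s => steps s /\ exists n z, pos x s n /\ op n z ∊ s /\ z ∊ P) S.
  by dfn.
have [|q hq] := @sep M (fun s => steps s /\ exists n z, pos x s n /\ op n z ∊ s /\ z ∊ Q) S.
  by dfn.
have str : wstrat x p q.
  split; first by move=> s [/hp|/hq] [_ [_ [n [z [? _]]]]]; exists n.
  split; last split.
  - move=> s /hp [_ [hs [n [z [ps [nz zP]]]]]]; have [u [uz [uQ zu]]] := hP _ zP.
    have [s' [ps' [ss' nu]]] := pos_extend ps nz uz.
    exists s'; split; first by exists n.
    apply/hq; split; first exact: hS ps'.
    by split; [apply: steps_mv ps nz ps' ss' nu zu hs|exists (sc n), u].
  - move=> s /hq [_ [hs [n [z [ps [nz zQ]]]]]] s' ms.
    have [ps' [ss' [v [nv vz]]]] := mv_last ms ps nz.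
    have [vP zv] := hQ _ zQ _ vz; apply/hp; split; first exact: hS ps'.
    by split; [apply: steps_mv ps nz ps' ss' nv zv hs|exists (sc n), v].
  - move=> b [[s0 s0b] hb].
    have hb' s : s ∊ b -> steps s /\ exists n z, pos x s n /\ op n z ∊ s /\ (z ∊ P \/ z ∊ Q).
      by case/hb => [/hp|/hq] [_ [hs [n [z [ps [nz zP]]]]]]; split=> //; exists n, z;
        split=> //; split=> //; [left|right].
    (* [B] consists of the last sets of the positions in [b]. A move inside [b] is an [R]-step
       inside [B], because its result satisfies [steps]; hence a terminal set of [B] comes from a
       terminal position of [b]. *)
    have [|B hB] := @sep M (fun z => exists s n, s ∊ b /\ pos x s n /\ op n z ∊ s) (cup P Q).
      by dfn.
    have inB s n z : s ∊ b -> pos x s n -> op n z ∊ s -> z ∊ B.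
      move=> sb ps nz; apply/hB; split; last by exists s, n.
      have [_ [n' [z' [ps' [nz' hz']]]]] := hb' _ sb.
      have e := pos_len ps' ps; subst n'; apply/in_cup.
      by rewrite (pos_uniq ps nz nz').
    have [||z [zB no]] := wf B.
    - have [_ [n [z [ps [nz _]]]]] := hb' _ s0b; exists z; exact: inB ps nz.
    - by move=> z /hB [/in_cup].
    have [_ [s [n [sb [ps nz]]]]] := iffLR (hB z) zB.
    exists s; split=> // -[s' [s'b ms]]; apply: no.
    have [ps' [ss' [v [nv vz]]]] := mv_last ms ps nz.
    have [hs' _] := hb' _ s'b; exists v; split; first exact: inB s'b ps' nv.
    by split=> //; apply: hs' (ss' _ nz) nv.
have st0 : steps (upr (op e0 x) (op e0 x)).
  move=> i u v /in_sing /op_inj [-> _] /in_sing /op_inj [/e0_eq /(_ e0) no _].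
  by case: no; apply: sc_self.
have p0 := pos_start x; split=> hx; exists p, q; split=> //;
  exists (upr (op e0 x) (op e0 x)); split=> //; [apply/hp|apply/hq];
  (split; first exact: hS p0); split=> //; exists e0, x; split=> //; split=> //;
  exact/in_sing.
Qed.

End Winning.

(** * Stages of the fixed-point iteration inside a transitive set *)

Section Stages.
Variable M : zf_model.
Implicit Types x y z u v w A B C F t Y : M.

Lemma nx_ex t A : exists B, forall z, z ∊ B <-> z ∊ A \/ (z ∊ t /\ exists u, u ∊ z /\ sub u A).
Proof.
have [|B hB] := @sep M (fun z => exists u, u ∊ z /\ sub u A) t; first by dfn.
by exists (cup A B) => z; rewrite in_cup hB.
Qed.

Definition nx t A := sval (constructive_indefinite_description _ (nx_ex t A)).

Lemma in_nx t A z : z ∊ nx t A <-> z ∊ A \/ (z ∊ t /\ exists u, u ∊ z /\ sub u A).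
Proof. by rewrite /nx; case: constructive_indefinite_description. Qed.

Lemma def_nx : Def3 (fun z t A => z = nx t A).
Proof.
apply: (@Dfn_ext _ (fun r => forall z, z ∊ r 0 <->
   z ∊ r 2 \/ (z ∊ r 1 /\ exists u, u ∊ z /\ sub u (r 2)))); last by dfn.
move=> r; split=> [h|-> z]; last exact: in_nx.
by apply: extensional => z; rewrite h in_nx.
Qed.

(** The transfinite iterates of [nx t], without ordinals: the subsets of [t] belonging to every
    family closed under the step and under unions. The union of the empty family is the first
    stage. *)
Definition game_stage t A :=
  sub A t /\ forall F, (forall B, B ∊ F -> nx t B ∊ F) ->
                    (forall Y, sub Y F -> Un Y ∊ F) -> A ∊ F.

End Stages.
#[global] Hint Resolve def_nx : dfn.

Lemma def_game_stage (M : zf_model) : Def2 (@game_stage M).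
Proof. by rewrite /game_stage; dfn. Qed.
#[global] Hint Resolve def_game_stage : dfn.

Section StageTheory.
Variables (M : zf_model) (t : M).
Implicit Types x y z u v w A B C F Y : M.
Hypothesis tt : trans t.

Lemma nx_sub A : sub A t -> sub (nx t A) t.
Proof. by move=> At z /in_nx [/At|[]]. Qed.

Lemma nx_incr A : sub A (nx t A).
Proof. by move=> z zA; apply/in_nx; left. Qed.

Lemma game_stage_nx A : game_stage t A -> game_stage t (nx t A).
Proof.
by move=> [At h]; split=> [|F h1 h2]; [apply: nx_sub|apply: (h1); apply: h].
Qed.

Lemma game_stage_Un Y : (forall A, A ∊ Y -> game_stage t A) -> game_stage t (Un Y).
Proof.
move=> hY; split=> [z /in_Un [A [/hY [At _]]]|F h1 h2]; first exact: At.
by apply: (h2) => A /hY [_]; apply.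
Qed.

Lemma game_stage_ind (P : M -> Prop) : Def1 P ->
  (forall A, game_stage t A -> P A -> P (nx t A)) ->
  (forall Y, (forall A, A ∊ Y -> game_stage t A /\ P A) -> P (Un Y)) ->
  forall A, game_stage t A -> P A.
Proof.
move=> dP h1 h2 A sA.
have [|F hF] := @sep M (fun A => game_stage t A /\ P A) (Pw t); first by dfn.
have [_ /(_ F) h] := sA; suff /hF [_ []] : A ∊ F by [].
apply: h => [B /hF [/in_Pw Bt [sB PB]]|Y YF]; apply/hF.
  have sB' := game_stage_nx sB.
  by split; [apply/in_Pw; case: sB'|split=> //; apply: h1].
have sY : game_stage t (Un Y) by apply: game_stage_Un => B /YF /hF [_ []].
by split; [apply/in_Pw; case: sY|split=> //; apply: h2 => B /YF /hF []].
Qed.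

Lemma sub_eq A B : sub A B -> sub B A -> A = B.
Proof. by move=> h1 h2; apply: extensional => z; split=> [/h1|/h2]. Qed.

(* Comparability of stages, as in the Bourbaki-Witt theorem. *)
Definition extreme C := forall A, game_stage t A -> sub A C -> A <> C -> sub (nx t A) C.

(** Stages below [C] do not jump over it, by extremality, so induction over the stages carries the
    alternative through steps and unions. *)
Lemma extreme_cmp C : extreme C ->
  forall A, game_stage t A -> sub A C \/ sub (nx t C) A.
Proof.
move=> eC; apply: game_stage_ind => [|A sA [AC|CA]|Y hY]; first by dfn.
- case: (classic (A = C)) => [->|ne]; first by right.
  by left; apply: eC.
- by right=> z /CA; apply: nx_incr.
- case: (classic (exists A, A ∊ Y /\ sub (nx t C) A)) => [[A [AY CA]]|no].
    by right=> z /CA zA; apply/in_Un; exists A.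
  left=> z /in_Un [A [AY zA]]; case: (hY _ AY) => _ [|CA]; first by apply.
  by case: no; exists A.
Qed.

Lemma all_extreme C : game_stage t C -> extreme C.
Proof.
move: C; apply: game_stage_ind => [|C sC eC|Y hY]; first by rewrite /extreme; dfn.
- move=> A sA AC ne; case: (extreme_cmp eC sA) => [AC'|CA]; last first.
    by case: ne; apply: sub_eq.
  case: (classic (A = C)) => [->//|ne'] z zA; apply: nx_incr; exact: eC zA.
- move=> A sA AY ne.
  have [B [BY AB]] : exists B, B ∊ Y /\ sub A B.
    apply: NNPP => no; apply: ne; apply: sub_eq => // z /in_Un [B [BY zB]].
    case: (hY _ BY) => _ /extreme_cmp /(_ A sA) [AB|BA]; first by case: no; exists B.
    by apply: BA; apply: nx_incr.
  have [sB eB] := hY _ BY; have BU : sub B (Un Y) by move=> z zB; apply/in_Un; exists B.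
  case: (classic (A = B)) => [e|ne']; last by move=> z zA; apply: BU; apply: eB zA.
  subst B; have sU : game_stage t (Un Y) by apply: game_stage_Un => B /hY [].
  by case: (extreme_cmp eB sU) => // UA; case: ne; apply: sub_eq.
Qed.

Lemma game_stage_cmp A C : game_stage t A -> game_stage t C ->
  sub A C \/ sub (nx t C) A.
Proof. by move=> sA /all_extreme /extreme_cmp; apply. Qed.

(** A comparison of ranks without ranks: [v] enters the iteration strictly earlier than [z], where a
    set that never enters counts as later. *)
Definition below z v := exists A, game_stage t A /\ ~ z ∊ A /\ v ∊ A.

(* The union of the stages that miss all of [B]. *)
Lemma avoiding_stage B : exists N, game_stage t N /\
  (forall z, z ∊ N -> ~ z ∊ B) /\
  forall A, game_stage t A -> (forall z, z ∊ A -> ~ z ∊ B) -> sub A N.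
Proof.
have [|Y hY] := @sep M (fun A => game_stage t A /\ forall z, z ∊ A -> ~ z ∊ B) (Pw t).
  by dfn.
exists (Un Y); split; first by apply: game_stage_Un => A /hY [_ []].
split=> [z /in_Un [A [/hY [_ [_ h]]]]|A sA hA z zA]; first exact: h.
apply/in_Un; exists A; split=> //; apply/hY; split=> //; apply/in_Pw.
by case: sA.
Qed.

Definition lfp_closed C := forall z, z ∊ t -> (exists u, u ∊ z /\ sub u C) -> z ∊ C.

Section Lfp.
Variable W0 : M.
Hypothesis hW0 : forall z, z ∊ W0 <-> z ∊ t /\ forall C, lfp_closed C -> z ∊ C.

Lemma W0_closed : lfp_closed W0.
Proof.
move=> z zt [u [uz uW]]; apply/hW0; split=> // C cC; apply: (cC) => //.
by exists u; split=> // v /uW /hW0 [_]; apply.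
Qed.

Lemma game_stage_sub_W0 A : game_stage t A -> sub A W0.
Proof.
move: A; apply: game_stage_ind => [|A sA AW z /in_nx [/AW//|[zt [u [uz uA]]]]|Y hY].
- by dfn.
- by apply: W0_closed => //; exists u; split=> // v /uA /AW.
- by move=> z /in_Un [A [/hY [_ AW]] /AW].
Qed.

(** [N] is the largest stage avoiding [B]. Were the next stage to avoid [B] as well, it would be
    included in [N]; then [N] would be closed and contain all of [W0], including [z]. *)
Lemma W0_step B z : z ∊ W0 -> z ∊ B -> exists N w, game_stage t N /\
  (forall v, v ∊ N -> ~ v ∊ B) /\ w ∊ nx t N /\ w ∊ B /\ w ∊ W0.
Proof.
move=> zW zB; have [N [sN [h1 h2]]] := avoiding_stage B.
apply: NNPP => no.
have h3 : sub (nx t N) N.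
  apply: h2; first exact: game_stage_nx.
  move=> w wN wB; apply: no; exists N, w; split=> //; split=> //; split=> //; split=> //.
  exact: game_stage_sub_W0 (game_stage_nx sN) _ wN.
apply: (h1 z) => //; have /hW0 [_] := zW; apply => w wt hw.
by apply: h3; apply/in_nx; right.
Qed.

Lemma W0_below z : z ∊ W0 -> exists u, u ∊ z /\ forall v, v ∊ u -> below z v.
Proof.
move=> zW; have [|N [w [sN [h1 [/in_nx wN [/in_sing e _]]]]]] :=
  @W0_step (upr z z) z zW; first exact/in_sing.
subst w; have zN : ~ z ∊ N by move=> /h1; case; apply/in_sing.
by case: wN => [//|[_ [u [uz uN]]]]; exists u; split=> // v /uN vN; exists N.
Qed.

Lemma below_wf B z : z ∊ W0 -> z ∊ B ->
  exists w, w ∊ W0 /\ w ∊ B /\ forall v, v ∊ B -> ~ below w v.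
Proof.
move=> zW zB; have [N [w [sN [h1 [wN [wB wW]]]]]] := W0_step zW zB.
exists w; split=> //; split=> // v vB [A [sA [wA vA]]].
case: (game_stage_cmp sA sN) => [AN|NA]; last by apply: wA; apply: NA.
exact: h1 (AN _ vA) vB.
Qed.

(** The players do not both win. The members of [W0] not included in [W0] form a closed set: if [u]
    consists of such members and were itself in [W0], it would have an element included in [W0]. *)
Lemma W0_not_sub z : z ∊ W0 -> ~ sub z W0.
Proof.
have [|C hC] := @sep M (fun z => ~ sub z W0) W0; first by dfn.
move=> /hW0 [_ /(_ C) h]; suff /h /hC [] : lfp_closed C by [].
move=> {h}z' zt [u [uz uC]]; have uW : sub u W0 by move=> v /uC /hC [].
apply/hC; split; first by apply: W0_closed => //; exists u.
move=> zW; have [w [wu ww]] := W0_below (zW _ uz).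
have /uC /hC [_] := wu; apply => v /ww [A [sA [_ vA]]].
exact: game_stage_sub_W0 sA _ vA.
Qed.

(* In [W0] one moves to a set all of whose elements entered the fixed point at
   an earlier stage; this makes the strategy canonical and its plays finite. *)
Lemma W0_strategy x : x ∊ t -> (x ∊ W0 -> Iw x) /\ (sub x W0 -> IIw x).
Proof.
move=> xt; have [|Q hQ] := @sep M (fun z => sub z W0) t; first by dfn.
(* From [W0] player I must make progress towards earlier stages; from [Q], where all elements lie in
   [W0], the opponent's moves are unrestricted. *)
pose R z u := (z ∊ W0 /\ forall v, v ∊ u -> below z v) \/ (z ∊ Q /\ u ∊ W0).
have disj z : z ∊ W0 -> ~ z ∊ Q by move=> /W0_not_sub h /hQ [_].
have [||||h1 h2] := @strategy_of_graph M x W0 Q R.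
- by rewrite /R /below; dfn.
- move=> z zW; have [u [uz hu]] := W0_below zW; exists u; split=> //; split; last by left.
  have /hW0 [zt _] := zW; apply/hQ; split; first exact: tt zt _ uz.
  by move=> v /hu [A [sA [_ vA]]]; apply: game_stage_sub_W0 sA _ vA.
- move=> z zQ v vz; have /hQ [_ /(_ _ vz) vW] := zQ.
  by split=> //; right.
(* If [B] meets [W0], take a [below]-minimal [w] there: either [w] is terminal in [B], or its
   successor [u] is, since successors of [u] would be [below] [w]. If [B] misses [W0], no [R]-step
   stays in [B], as each has an end in [W0]. *)
- move=> B ne hB; case: (classic (exists z, z ∊ W0 /\ z ∊ B)) => [[z [zW zB]]|no].
    have [w [wW [wB hw]]] := below_wf zW zB.
    case: (classic (exists u, u ∊ B /\ u ∊ w /\ R w u)) => [[u [uB [uw wu]]]|]; last by exists w.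
    have hu v : v ∊ u -> below w v by case: wu => [[_ h]|[wQ _]]; [apply: h|case: (disj _ wW wQ)].
    have uQ : u ∊ Q.
      have /hW0 [wt _] := wW; apply/hQ; split; first exact: tt wt _ uw.
      by move=> v /hu [A [sA [_ vA]]]; apply: game_stage_sub_W0 sA _ vA.
    by exists u; split=> // -[v [vB [/hu vw _]]]; apply: hw vw.
  have [z zB] := ne; exists z; split=> // -[u [uB [uz [[zW _]|[_ uW]]]]]; apply: no.
    by exists z.
  by exists u.
- by split=> // xW; apply: h2; apply/hQ.
Qed.

End Lfp.

Lemma W0_ex : exists W0, forall z, z ∊ W0 <-> z ∊ t /\ forall C, lfp_closed C -> z ∊ C.
Proof. by apply: sep; rewrite /lfp_closed; dfn. Qed.

Lemma win_iff W0 : (forall z, z ∊ W0 <-> z ∊ t /\ forall C, lfp_closed C -> z ∊ C) ->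
  forall x, x ∊ t -> (Iw x <-> x ∊ W0) /\ (IIw x <-> sub x W0).
Proof.
move=> hW x xt; have [h1 h2] := W0_strategy hW xt.
(* The class must be closed for arbitrary sets, not just for elements of [t]; making membership in
   [t] a premise turns the local fixed point into such a class. *)
have [||h3 h4] := @win_closed M x (fun z => z ∊ t -> z ∊ W0); first by dfn.
  move=> z [u [uz hu]] zt; apply: (W0_closed hW) => //; exists u; split=> // v vu.
  by apply: hu => //; apply: tt (tt zt uz) _ vu.
split; split=> //; first by move/h3; apply.
by move=> /h4 h z zx; apply: h => //; apply: tt xt _ zx.
Qed.

End StageTheory.

(** * Recursive equations for the winning sets; closure of W and HW *)

Section WinningTheory.
Variable M : zf_model.
Implicit Types x y z u v w t : M.

Lemma win_local x : exists t W0 : M, trans t /\ x ∊ t /\ lfp_closed t W0 /\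
  (forall z, z ∊ W0 -> exists u, u ∊ z /\ sub u W0) /\
  forall z, z ∊ t -> (Iw z <-> z ∊ W0) /\ (IIw z <-> sub z W0).
Proof.
have [t [tt [xt _]]] := tc_ex x; have [W0 hW] := W0_ex t; exists t, W0.
split=> //; split=> //; split; first exact: W0_closed.
split; last exact: win_iff.
move=> z /(W0_below hW) [u [uz hu]]; exists u; split=> // v /hu [A [sA [_ vA]]].
exact: (game_stage_sub_W0 hW) vA.
Qed.

(** Both sides are read off one local fixed point, so strategies for different elements never have
    to be chosen and glued; this is how choice is avoided. *)
Lemma Iw_iff x : Iw x <-> exists u, u ∊ x /\ IIw u.
Proof.
have [t [W0 [tt [xt [cW [uW h]]]]]] := win_local x.
have [-> _] := h _ xt; split=> [/uW [u [ux us]]|[u [ux hu]]].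
  by exists u; split=> //; have [_ hII] := h u (tt _ xt _ ux); apply/hII.
apply: cW => //; exists u; split=> //.
by have [_ hII] := h u (tt _ xt _ ux); apply/hII.
Qed.

Lemma IIw_iff x : IIw x <-> forall v, v ∊ x -> Iw v.
Proof.
have [t [W0 [tt [xt [_ [_ h]]]]]] := win_local x.
have [_ ->] := h _ xt; by split=> hx v vx; have [hI _] := h v (tt _ xt _ vx); apply/hI; apply: hx.
Qed.

Lemma Wi_closed x : (forall z, z ∊ x -> Wi z) -> Wi x.
Proof.
move=> hx; case: (classic (exists u, u ∊ x /\ IIw u)) => [/Iw_iff|no]; first by left.
right; apply/IIw_iff => v vx; case: (hx _ vx) => // hv.
by case: no; exists v.
Qed.

Lemma IIw_e0 : IIw (@e0 M).
Proof. by apply/IIw_iff => v /in_e0. Qed.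

Lemma Iw_e0_in x : e0 ∊ x -> Iw x.
Proof. by move=> h; apply/Iw_iff; exists e0; split=> //; apply: IIw_e0. Qed.

Definition HWi x := exists t, is_tc t x /\ forall z, z ∊ t -> Wi z.

Lemma HWi_Wi x : HWi x -> Wi x.
Proof. by move=> [t [[_ [xt _]] h]]; apply: h. Qed.

Lemma HWi_in x y : HWi x -> y ∊ x -> HWi y.
Proof.
move=> [t [[tt [xt _]] h]] yx; have [t' ht'] := tc_ex y; exists t'; split=> // z zt'.
apply: h; have [_ [_ m]] := ht'; apply: (m t tt _ z zt'); exact: tt xt _ yx.
Qed.

Lemma HWi_closed x : (forall z, z ∊ x -> HWi z) -> HWi x.
Proof.
move=> hx; have [t ht] := tc_ex x; exists t; split=> //; have [tt [xt m]] := ht.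
(* The hereditarily winning elements of [t], together with [x], form a transitive set and therefore
   exhaust [t]. *)
have [|T hT] := @sep M (fun z => z = x \/ HWi z) t.
  by rewrite /HWi /is_tc; dfn.
have h z : z ∊ t -> z ∊ T.
  apply: m => [u /hT [ut hu] v vu|]; last by apply/hT; split=> //; left.
  apply/hT; split; first exact: tt ut _ vu.
  right; case: hu => [e|hu]; first by apply: hx; rewrite -e.
  exact: HWi_in hu vu.
move=> z /h /hT [_ [->|/HWi_Wi //]].
by apply: Wi_closed => w /hx /HWi_Wi.
Qed.

End WinningTheory.

(** * Meaning of the defined formulas *)

Section Meaning.
Variable M : zf_model.
Implicit Types r : nat -> M.
Notation sat := (sat (@mem M)).

Lemma sat_subset r x y : sat r (subset x y) <-> sub (r x) (r y).
Proof. by rewrite /subset /sub; sat_tac. Qed.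

Lemma sat_empty r x : sat r (empty x) <-> r x = e0.
Proof. by rewrite e0_eq /empty; sat_tac. Qed.

Lemma sat_nonempty r x : sat r (nonempty x) <-> exists z, z ∊ r x.
Proof. by rewrite /nonempty; sat_tac. Qed.

Lemma sat_upair r z a b : sat r (upair z a b) <-> r z = upr (r a) (r b).
Proof. by rewrite upr_eq /upair; sat_tac. Qed.

Lemma sat_succ r s x : sat r (succ s x) <-> r s = sc (r x).
Proof. by rewrite sc_eq /succ; sat_tac. Qed.

Hint Resolve sat_subset sat_empty sat_nonempty sat_upair sat_succ : sat.

Lemma sat_opair r z a b : sat r (opair z a b) <-> r z = op (r a) (r b).
Proof.
transitivity (exists u v, u = upr (r a) (r a) /\ v = upr (r a) (r b) /\ r z = upr u v).
  by rewrite /opair; sat_tac.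
split=> [[u [v [-> [-> ->]]]]|->] //.
by exists (upr (r a) (r a)), (upr (r a) (r b)).
Qed.

Lemma sat_power r p x : sat r (power p x) <-> r p = Pw (r x).
Proof. by rewrite Pw_eq /power; sat_tac. Qed.

Lemma sat_transitive_set r x : sat r (transitive_set x) <-> trans (r x).
Proof. by rewrite /transitive_set /trans; sat_tac. Qed.

Lemma sat_ordinal r x : sat r (ordinal x) <-> Ord (r x).
Proof. by rewrite /ordinal /Ord /has_minimal /transitive_set /trans; sat_tac. Qed.

Lemma sat_successor r x : sat r (successor x) <-> exists c, r x = sc c.
Proof. by rewrite /successor; sat_tac. Qed.

Hint Resolve sat_opair sat_power sat_transitive_set sat_ordinal sat_successor : sat.

Lemma sat_limit r x : sat r (limit x) <-> Lim (r x).
Proof. by rewrite /limit /Lim; sat_tac. Qed.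

Lemma sat_natural r x : sat r (natural x) <-> Nat (r x).
Proof. by rewrite /natural /Nat; sat_tac. Qed.

Lemma sat_maps r f x y : sat r (maps f x y) <-> op (r x) (r y) ∊ r f.
Proof.
transitivity (exists p, p ∊ r f /\ p = op (r x) (r y)); first by rewrite /maps; sat_tac.
by split=> [[p [h <-]]|h] //; exists (op (r x) (r y)).
Qed.

Hint Resolve sat_limit sat_natural sat_maps : sat.

Lemma sat_function_on r f d : sat r (function_on f d) <-> fun_on (r f) (r d).
Proof. by rewrite /function_on /fun_on; sat_tac. Qed.

Hint Resolve sat_function_on : sat.

Lemma sat_hierarchy r f d : sat r (hierarchy f d) <-> Hier (r f) (r d).
Proof. by rewrite /hierarchy /Hier; sat_tac. Qed.

Hint Resolve sat_hierarchy : sat.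

Lemma sat_V_stage r a v : sat r (V_stage a v) <-> Stage (r a) (r v).
Proof. by rewrite /V_stage /Stage; sat_tac. Qed.

Hint Resolve sat_V_stage : sat.

Lemma sat_Vinf r x : sat r (Vinf x) <-> Vi (r x).
Proof. by rewrite /Vinf /Vi; sat_tac. Qed.

Lemma sat_position r x s n : sat r (position x s n) <-> pos (r x) (r s) (r n).
Proof.
transitivity (Nat (r n) /\ (exists d, d = sc (r n) /\ fun_on (r s) d) /\
  (exists e, e = e0 /\ op e (r x) ∊ r s) /\
  forall i j u v, j = sc i /\ op i u ∊ r s /\ op j v ∊ r s -> v ∊ u).
  by rewrite /position; sat_tac.
split=> [[nn [[d [-> f]] [[e [-> h]] hs]]]|[nn [f [h hs]]]].
  by split=> //; split=> //; split=> // i u v iu iv; apply: (hs i (sc i)).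
split=> //; split; first by exists (sc (r n)).
split; first by exists e0.
by move=> i j u v [-> [iu iv]]; apply: hs iu iv.
Qed.

Hint Resolve sat_position : sat.

Lemma sat_initial_position r x s : sat r (initial_position x s) <-> pos (r x) (r s) e0.
Proof.
transitivity (exists e, e = e0 /\ pos (r x) (r s) e).
  by rewrite /initial_position; sat_tac.
by split=> [[e [->]]|h] //; exists e0.
Qed.

Lemma sat_move r x s s' : sat r (move x s s') <-> mv (r x) (r s) (r s').
Proof.
transitivity (exists n m, pos (r x) (r s) n /\ m = sc n /\ pos (r x) (r s') m /\
  sub (r s) (r s')); first by rewrite /move; sat_tac.
split=> [[n [m [h1 [-> [h2 h3]]]]]|[n [h1 [h2 h3]]]]; first by exists n.
by exists n, (sc n).
Qed.

Hint Resolve sat_initial_position sat_move : sat.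

Lemma sat_winning_strategy r x p q :
  sat r (winning_strategy x p q) <-> wstrat (r x) (r p) (r q).
Proof. by rewrite /winning_strategy /wstrat; sat_tac. Qed.

Hint Resolve sat_winning_strategy : sat.

Lemma sat_W r x : sat r (W x) <-> Wi (r x).
Proof. by rewrite /W /I_wins /II_wins /Wi /Iw /IIw; sat_tac. Qed.

Hint Resolve sat_W : sat.

Lemma sat_HW r x : sat r (HW x) <-> HWi (r x).
Proof.
transitivity (exists s t, s = upr (r x) (r x) /\
  (trans t /\ sub s t /\ forall T, trans T /\ sub s T -> sub t T) /\
  forall z, z ∊ t -> Wi z); first by rewrite /HW /trans_closure; sat_tac.
have e t : sub (upr (r x) (r x)) t <-> r x ∊ t.
  by split=> [|h z /in_sing -> //]; apply; apply/in_sing.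
split=> [[s [t [-> [[h1 [/e h2 h3]] h4]]]]|[t [[h1 [h2 h3]] h4]]].
  by exists t; split=> //; split=> //; split=> // T tT xT; apply: h3; rewrite e.
exists (upr (r x) (r x)), t; split=> //; split=> //; split=> //; split; first exact/e.
by move=> T [tT /e xT]; apply: h3.
Qed.

End Meaning.
#[global] Hint Resolve sat_W sat_HW sat_Vinf : sat.

(** * The five cases are exhaustive and mutually exclusive *)

Section Trichotomy.
Variable M : zf_model.
Implicit Types (r : nat -> M) (x y z : M).
Notation sat := (sat (@mem M)).

Definition reg_in (K : M -> Prop) :=
  forall y, K y -> (exists z, K z /\ z ∊ y) ->
    exists z, K z /\ z ∊ y /\ ~ exists w, K w /\ w ∊ y /\ w ∊ z.

Definition coext (K L : M -> Prop) := forall x, K x <-> L x.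

Lemma sat_class_eq r (C D : class) K L :
  (forall r (x : nat), sat r (C x) <-> K (r x)) -> (forall r (x : nat), sat r (D x) <-> L (r x)) ->
  sat r (class_eq C D) <-> coext K L.
Proof. by move=> hC hD; apply: sat_all => m; apply: sat_iff; [apply: hC|apply: hD]. Qed.

Lemma sat_AR r : sat r AR <-> reg_in (fun=> True).
Proof.
transitivity (forall y, (exists z, z ∊ y) ->
    exists z, z ∊ y /\ ~ exists w, w ∊ y /\ w ∊ z); first by rewrite /AR /nonempty; sat_tac.
split=> h y; [move=> _ [z [_ zy]]|move=> [z zy]].
  have [|m [my no]] := h y; first by exists z.
  by exists m; split=> //; split=> // -[w [_ hw]]; apply: no; exists w.
have [//||m [_ [my no]]] := h y; first by exists z.
by exists m; split=> // -[w hw]; apply: no; exists w.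
Qed.

Lemma sat_rel_AR r (C : class) K :
  (forall r (x : nat), sat r (C x) <-> K (r x)) -> sat r (relativize C AR) <-> reg_in K.
Proof.
(* [ExC] is what [relativize] makes of an existential quantifier, which is itself a negated
   universal one. *)
move=> hC; pose ExC A := Neg (All (Imp (C 0) (Neg A))).
have rex r' A P : (forall m, sat (scons m r') A <-> P m) ->
    (sat r' (ExC A) <-> exists m, K m /\ P m).
  move=> hA; split=> [h|[m [Km /hA Pm]] h]; last by apply: (h m) => //; apply/hC.
  apply: NNPP => no; apply: h => m /hC Km /hA Pm; apply: no; by exists m.
have -> : relativize C AR = All (Imp (C 0) (Imp (ExC (Elem 0 1))
    (ExC (And (Elem 0 1) (Neg (ExC (And (Elem 0 2) (Elem 0 1)))))))) by [].
apply: sat_all => y; apply: sat_imp; first exact: hC.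
apply: sat_imp; first by apply: rex => z.
apply: (rex) => z; apply: sat_and; first by [].
by apply: sat_neg; apply: rex => w; apply: sat_and.
Qed.

Lemma coext_sym (K L : M -> Prop) : coext K L -> coext L K.
Proof. by move=> h x; rewrite h. Qed.

Lemma reg_in_coext (K L : M -> Prop) : coext K L -> reg_in K -> reg_in L.
Proof.
move=> e h y /e Ky [z [/e Kz zy]]; have [|m [Km [my no]]] := h y Ky; first by exists z.
exists m; split; first exact/e.
by split=> // -[w [/e Kw hw]]; apply: no; exists w.
Qed.

Lemma Vi_ind (P : M -> Prop) : Def1 P ->
  (forall x, Vi x -> (forall y, y ∊ x -> P y) -> P x) -> forall x, Vi x -> P x.
Proof.
move=> dP step x vx; apply: NNPP => nP; have [t [tt [xt _]]] := tc_ex x.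
have [|b hb] := @sep M (fun z => Vi z /\ ~ P z) t; first by dfn.
have [|m [/hb [mt [vm nm]] no]] := @Vi_minimal M x b _ vx; first exact/hb.
apply: nm; apply: step => // y ym; apply: NNPP => ny; apply: no; exists y; split=> //.
apply/hb; split; first exact: tt mt _ ym.
by split=> //; apply: Vi_trans vm ym.
Qed.

Lemma def_HWi : Def1 (@HWi M).
Proof. by rewrite /HWi /is_tc; dfn. Qed.

Lemma Vi_HWi x : Vi x -> HWi x.
Proof.
move: x; apply: Vi_ind => [|x _ h]; first exact: def_HWi.
exact: HWi_closed.
Qed.

Lemma reg_Vi : reg_in (@Vi M).
Proof.
move=> y vy [z [vz zy]]; have [m [my no]] := Vi_minimal zy vz.
exists m; split; first exact: Vi_trans vy my.
by split=> // -[w [_ hw]]; apply: no; exists w.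
Qed.

Notation All_ := (fun _ : M => True).

Lemma reg_all_Vi : reg_in All_ -> forall x, Vi x.
Proof.
move=> reg x; apply: NNPP => nx; have [t [tt [xt _]]] := tc_ex x.
have [|b hb] := @sep M (fun z => ~ Vi z) t; first by dfn.
have [//||m [_ [/hb [mt nm] no]]] := reg b.
  by exists x; split=> //; apply/hb.
apply: nm; apply: Vi_closed => y ym; apply: NNPP => ny; apply: no; exists y; split=> //.
by split=> //; apply/hb; split=> //; apply: tt mt _ ym.
Qed.

Lemma HWi_not_Vi x : HWi x -> ~ Vi x -> exists y, HWi y /\ (exists z, z ∊ y) /\
  (forall z, z ∊ y -> HWi z) /\ forall z, z ∊ y -> exists w, w ∊ y /\ w ∊ z.
Proof.
move=> hx nx; have [t [tt [xt _]]] := tc_ex x; have dH := def_HWi.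
have [|b hb] := @sep M (fun z => HWi z /\ ~ Vi z) t; first by dfn.
have hH z : z ∊ b -> HWi z by move=> /hb [_ []].
exists b; split; first exact: HWi_closed.
split; first by exists x; apply/hb.
split=> // z /hb [zt [hz nz]]; apply: NNPP => no; apply: nz; apply: Vi_closed => y yz.
apply: NNPP => ny; apply: no; exists y; split=> //; apply/hb; split; first exact: tt zt _ yz.
by split=> //; apply: HWi_in hz yz.
Qed.

Lemma all_Wi_of_coext : coext (@Wi M) (@HWi M) -> forall x, Wi x.
Proof.
move=> e x; apply: NNPP => nx.
have /e hy : Wi (upr e0 x) by left; apply: Iw_e0_in; apply/in_upr; left.
by apply: nx; apply: HWi_Wi; apply: HWi_in hy _; apply/in_upr; right.
Qed.

(** At most three facts determine all six conjuncts of a case. This serves both the case distinction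
    and the consistency models, which have only these facts to check. *)
Lemma five_cases r :
  (reg_in All_ -> sat r case1) /\
  (~ coext All_ (@Wi M) -> coext (@HWi M) (@Vi M) -> reg_in (@Wi M) -> sat r case2) /\
  (~ coext All_ (@Wi M) -> coext (@HWi M) (@Vi M) -> ~ reg_in (@Wi M) -> sat r case3) /\
  (~ reg_in All_ -> coext All_ (@Wi M) -> sat r case4) /\
  (~ coext All_ (@Wi M) -> ~ coext (@HWi M) (@Vi M) -> sat r case5).
Proof.
have sV (r' : nat -> M) (x : nat) : sat r' (V x) <-> True by split.
have sVW : sat r (class_eq V W) <-> coext All_ (@Wi M).
  by apply: sat_class_eq; [apply: sV|apply: sat_W].
have sWH : sat r (class_eq W HW) <-> coext (@Wi M) (@HWi M).
  by apply: sat_class_eq; [apply: sat_W|apply: sat_HW].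
have sHV : sat r (class_eq HW Vinf) <-> coext (@HWi M) (@Vi M).
  by apply: sat_class_eq; [apply: sat_HW|apply: sat_Vinf].
have sA := sat_AR r.
have sAW : sat r (relativize W AR) <-> reg_in (@Wi M) by apply: sat_rel_AR; apply: sat_W.
have sAH : sat r (relativize HW AR) <-> reg_in (@HWi M) by apply: sat_rel_AR; apply: sat_HW.
have c1 A1 A2 A3 A4 A5 A6 P1 P2 P3 P4 P5 P6 :
  (sat r A1 <-> P1) -> (sat r A2 <-> P2) -> (sat r A3 <-> P3) -> (sat r A4 <-> P4) ->
  (sat r A5 <-> P5) -> (sat r A6 <-> P6) ->
  (sat r (And A1 (And A2 (And A3 (And A4 (And A5 A6))))) <->
   P1 /\ P2 /\ P3 /\ P4 /\ P5 /\ P6).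
  by move=> *; do 5?[apply: sat_and => //].
have nVW : ~ coext All_ (@Wi M) -> ~ coext (@Wi M) (@HWi M).
  by move=> h /all_Wi_of_coext h'; apply: h => x; split.
have nAR : ~ coext All_ (@Wi M) -> ~ reg_in All_.
  by move=> h /reg_all_Vi h'; apply: h => x; split=> // _; apply/HWi_Wi/Vi_HWi.
have HV_reg : coext (@HWi M) (@Vi M) -> reg_in (@HWi M).
  by move=> e; apply: reg_in_coext (coext_sym e) reg_Vi.
have nHV : ~ coext (@HWi M) (@Vi M) -> ~ reg_in (@Wi M) /\ ~ reg_in (@HWi M).
  move=> h; have [x [hx nx]] : exists x : M, HWi x /\ ~ Vi x.
    apply: NNPP => no; apply: h => x; split=> [hx|]; last exact: Vi_HWi.
    by apply: NNPP => nx; apply: no; exists x.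
  have [y [hy [[z zy] [yH no]]]] := HWi_not_Vi hx nx; split=> reg.
    have [||m [_ [my nom]]] := reg y; first exact: HWi_Wi.
      by exists z; split=> //; apply/HWi_Wi/yH.
    by have [w [wy wm]] := no _ my; apply: nom; exists w; split=> //; apply/HWi_Wi/yH.
  have [//||m [_ [my nom]]] := reg y; first by exists z; split=> //; apply: yH.
  by have [w [wy wm]] := no _ my; apply: nom; exists w; split=> //; apply: yH.
split; last split; last split; last split.
- move=> reg; have vi := reg_all_Vi reg.
  have hh x : HWi x := Vi_HWi (vi x); have ww x := HWi_Wi (hh x).
  apply/c1; [exact: sVW|exact: sWH|exact: sHV|exact: sA|exact: sAW|exact: sAH|].
  have e1 : coext All_ (@Wi M) by [].
  have e2 : coext (@Wi M) (@HWi M) by [].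
  by do 4!split=> //; split; apply: reg_in_coext reg.
- move=> nV hV reg.
  apply/c1; [exact: sat_neg sVW|exact: sat_neg sWH|exact: sHV|exact: sat_neg sA|exact: sAW|exact: sAH|].
  by split=> //; split; [apply: nVW|split=> //; split; [apply: nAR|split=> //; apply: HV_reg]].
- move=> nV hV reg.
  apply/c1; [exact: sat_neg sVW|exact: sat_neg sWH|exact: sHV|exact: sat_neg sA|exact: sat_neg sAW|exact: sAH|].
  by split=> //; split; [apply: nVW|split=> //; split; [apply: nAR|split=> //; apply: HV_reg]].
- move=> nreg eVW.
  apply/c1; [exact: sVW|exact: sWH|exact: sat_neg sHV|exact: sat_neg sA|exact: sat_neg sAW|exact: sat_neg sAH|].
  have hh x : HWi x by have [t ht] := tc_ex x; exists t; split=> // z _; apply/eVW.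
  have e2 : coext (@Wi M) (@HWi M) by move=> x; rewrite -eVW.
  have nh : ~ reg_in (@HWi M) by move=> reg; apply: nreg; apply: reg_in_coext reg.
  split=> //; split=> //; split; first by move=> /HV_reg.
  split=> //; split=> // reg; apply: nh; exact: reg_in_coext reg.
- move=> nV hV; have [n1 n2] := nHV hV.
  apply/c1; [exact: sat_neg sVW|exact: sat_neg sWH|exact: sat_neg sHV|exact: sat_neg sA|exact: sat_neg sAW|exact: sat_neg sAH|].
  by split=> //; split; [apply: nVW|split=> //; split; [apply: nAR|]].
Qed.

Lemma sat_none_of r l : (forall B, List.In B l -> ~ sat r B) -> sat r (none_of l).
Proof.
elim: l => [|A l IH] h; first by [].
change (sat r (And (Neg A) (none_of l))).
apply: (iffRL (sat_and (iff_refl _) (iff_refl _))); split; first by apply: h; left.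
by apply: IH => B Bl; apply: h; right.
Qed.

Lemma sat_exactly_one r l A l' : sat r A ->
  (forall B, List.In B l -> ~ sat r B) -> (forall B, List.In B l' -> ~ sat r B) ->
  sat r (exactly_one (l ++ A :: l')).
Proof.
move=> hA; elim: l => [|C l IH] h h'.
  change (sat r (Or (And A (none_of l')) (And (Neg A) (exactly_one l')))).
  apply: (iffRL (sat_or (iff_refl _) (iff_refl _))); left.
  apply: (iffRL (sat_and (iff_refl _) (iff_refl _))); split=> //.
  exact: sat_none_of.
change (sat r (Or (And C (none_of (l ++ A :: l')))
                  (And (Neg C) (exactly_one (l ++ A :: l'))))).
apply: (iffRL (sat_or (iff_refl _) (iff_refl _))); right.
apply: (iffRL (sat_and (iff_refl _) (iff_refl _))); split; first by apply: h; left.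
by apply: IH => // B Bl; apply: h; right.
Qed.

Lemma exactly_one_case r : sat r (exactly_one [:: case1; case2; case3; case4; case5]).
Proof.
have [h1 [h2 [h3 [h4 h5]]]] := five_cases r.
have some : sat r case1 \/ sat r case2 \/ sat r case3 \/ sat r case4 \/ sat r case5.
  case: (classic (reg_in All_)) => [/h1|n1]; first by left.
  case: (classic (coext All_ (@Wi M))) => [e|n2]; first by right; right; right; left; apply: h4.
  case: (classic (coext (@HWi M) (@Vi M))) => [e|n3]; last by do 4!right; apply: h5.
  by case: (classic (reg_in (@Wi M))) => [reg|n4]; right; [left; apply: h2|right; left; apply: h3].
(* These conjuncts suffice for exclusivity: V = W separates 1 and 4 from the rest, AR separates 1
   from 4, HW = V_∞ separates 5 from 2 and 3, and the regularity of W separates 2 from 3. *)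
pose a1 := sat r (class_eq V W); pose a3 := sat r (class_eq HW Vinf).
pose a4 := sat r AR; pose a5 := sat r (relativize W AR).
have aE A B : sat r (And A B) -> sat r A /\ sat r B.
  by move=> h; apply: (iffLR (sat_and (iff_refl _) (iff_refl _)) h).
have p1 : sat r case1 -> a1 /\ a4 by move=> /aE [? /aE [_ /aE [_ /aE [? _]]]].
have p2 : sat r case2 -> ~ a1 /\ a3 /\ a5.
  by move=> /aE [? /aE [_ /aE [? /aE [_ /aE [? _]]]]].
have p3 : sat r case3 -> ~ a1 /\ a3 /\ ~ a5.
  by move=> /aE [? /aE [_ /aE [? /aE [_ /aE [? _]]]]].
have p4 : sat r case4 -> a1 /\ ~ a4 by move=> /aE [? /aE [_ /aE [_ /aE [? _]]]].
have p5 : sat r case5 -> ~ a1 /\ ~ a3 by move=> /aE [? /aE [_ /aE [? _]]].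
move: some p1 p2 p3 p4 p5; move: a1 a3 a4 a5 => a1 a3 a4 a5.
move: case1 case2 case3 case4 case5 => c1 c2 c3 c4 c5.
case=> [h|[h|[h|[h|h]]]] p1 p2 p3 p4 p5.
- apply: (@sat_exactly_one r [::]) => // B /= hB; intuition (subst; tauto).
- apply: (@sat_exactly_one r [:: c1]) => // B /= hB; intuition (subst; tauto).
- apply: (@sat_exactly_one r [:: c1; c2]) => // B /= hB; intuition (subst; tauto).
- apply: (@sat_exactly_one r [:: c1; c2; c3]) => // B /= hB; intuition (subst; tauto).
- apply: (@sat_exactly_one r [:: c1; c2; c3; c4]) => // B /= hB; intuition (subst; tauto).
Qed.

End Trichotomy.

Lemma ZFminus_exactly_one :
  proves ZFminus (exactly_one [:: case1; case2; case3; case4; case5]).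
Proof.
apply: completeness => [||N E hN r]; [exact: ZFminus_closed|by []|].
exact: (@exactly_one_case (@ZfModel N (r 0) E hN) r).
Qed.

(** * Second-order models *)

(* A membership relation for which the sets are exactly the small families. *)
Record family_model := FamilyModel {
  fdom :> Type;
  fmem : fdom -> fdom -> Prop;
  fidx : fdom -> Type;
  felt : forall u, fidx u -> fdom;
  fam : forall I : Type, (I -> fdom) -> fdom;
  fmem_elt : forall z u, fmem z u <-> exists i : fidx u, z = felt i;
  fmem_fam : forall I (g : I -> fdom) z, fmem z (fam g) <-> exists i, z = g i;
  fmem_ext : forall x y, (forall z, fmem z x <-> fmem z y) -> x = y }.

Section FamilyZF.
Variable U : family_model.
Notation E := (@fmem U).
Implicit Types (r : nat -> U) (x y z : U).

Definition fempty : U := fam (fun i : False => match i with end).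

Lemma in_fempty z : ~ E z fempty.
Proof. by move=> /fmem_fam [[]]. Qed.

Definition fsucc x : U := fam (fun o : option (fidx x) => if o is Some i then felt i else x).

Lemma in_fsucc x z : E z (fsucc x) <-> E z x \/ z = x.
Proof.
rewrite fmem_fam fmem_elt; split=> [[[i|] ->]|[[i ->]|->]]; first by left; exists i.
- by right.
- by exists (Some i).
- by exists None.
Qed.

Lemma family_sep a (P : U -> Prop) : exists b, forall z, E z b <-> E z a /\ P z.
Proof.
exists (fam (fun i : {i : fidx a | P (felt i)} => felt (sval i))) => z.
rewrite fmem_fam fmem_elt; split=> [[[i Pi] ->]|[[i ->] Pi]]; first by split=> //; exists i.
by exists (exist _ i Pi).
Qed.

Lemma family_repl a (R : U -> U -> Prop) :
  (forall x, E x a -> forall y y', R x y /\ R x y' -> y = y') ->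
  exists b, forall y, E y b <-> exists x, E x a /\ R x y.
Proof.
(* The relation may be partial, so only the indices having a value are retained, and the description
   axiom reads the value off. *)
move=> fR; pose J := {i : fidx a | exists y, R (felt i) y}.
pose h (j : J) := constructive_indefinite_description _ (proj2_sig j).
exists (fam (fun j => sval (h j))) => y; rewrite fmem_fam; split=> [[j ->]|[x [xa Rxy]]].
  exists (felt (sval j)); split; first by apply/fmem_elt; exists (sval j).
  exact: (proj2_sig (h j)).
have /fmem_elt [i ex] := xa; subst x.
pose j : J := exist _ i (ex_intro _ y Rxy).
by exists j; apply: (fR _ xa); split=> //; apply: (proj2_sig (h j)).
Qed.

Lemma family_zf r A : ZFminus A -> sat E r A.
Proof.
case=> {A}.
- have -> : sat E r extensionality <->
    forall x y, (forall z, E z x <-> E z y) -> x = y by rewrite /extensionality; sat_tac.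
  exact: fmem_ext.
- have -> : sat E r pairing <->
    forall a b, exists z, forall w, E w z <-> w = a \/ w = b.
    by rewrite /pairing /upair; sat_tac.
  move=> a b; exists (fam (fun i : bool => if i then a else b)) => w; rewrite fmem_fam.
  by split=> [[[] ->]|[->|->]]; [left|right|exists true|exists false].
- have -> : sat E r union_axiom <->
    forall x, exists u, forall z, E z u <-> exists y, E y x /\ E z y.
    by rewrite /union_axiom /union; sat_tac.
  move=> x; exists (fam (fun p : {i : fidx x & fidx (felt i)} => felt (projT2 p))) => z.
  rewrite fmem_fam; split=> [[[i j] ->]|[y [/fmem_elt [i ->] /fmem_elt [j ->]]]].
    by exists (felt i); split; apply/fmem_elt; [exists i|exists j].
  by exists (existT (fun i => fidx (felt i)) i j).
- have -> : sat E r power_axiom <->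
    forall x, exists p, forall z, E z p <-> forall w, E w z -> E w x.
    by rewrite /power_axiom /power /subset; sat_tac.
  (* Subsets are indexed by predicates on the index type of [x]. Families may repeat elements, so
     several predicates may name the same subset. *)
  move=> x; exists (fam (fun P : fidx x -> Prop =>
    fam (fun i : {i : fidx x | P i} => felt (sval i)))) => z.
  rewrite fmem_fam; split=> [[P ->] w /fmem_fam [[i Pi] ->]|h].
    by apply/fmem_elt; exists i.
  exists (fun i => E (felt i) z); apply: fmem_ext => w; rewrite fmem_fam.
  split=> [wz|[[i zi] ->]] //; have /fmem_elt [i e] := h _ wz; subst w.
  by exists (exist _ i wz).
- have -> : sat E r infinity <->
    exists I, (exists e, (forall z, ~ E z e) /\ E e I) /\
      (forall x, E x I -> exists y, (forall z, E z y <-> E z x \/ z = x) /\ E y I).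
    by rewrite /infinity /empty /succ; sat_tac.
  exists (fam (fun n : nat => iter n fsucc fempty)); split.
    by exists fempty; split=> [z|]; [apply: in_fempty|apply/fmem_fam; exists 0].
  move=> x /fmem_fam [n ->]; exists (iter n.+1 fsucc fempty).
  by split=> [z|]; [apply: in_fsucc|apply/fmem_fam; exists n.+1].
- move=> A; move: r; apply/sat_univ_closure => r a.
  have h : sat E (scons a r) (Ex (All (Iff (Elem 0 1) (And (Elem 0 2) (rename (up S) A)))))
    <-> exists b, forall z, E z b <-> E z a /\ sat E (scons z (scons a r)) A.
    apply: sat_ex => b; apply: sat_all => z; apply: sat_iff; first by [].
    apply: sat_and; first by [].
    by rewrite sat_rename; apply: sat_ext => -[].
  by apply/h; apply: family_sep.
- move=> A; move: r; apply/sat_univ_closure => r a.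
  pose R x y := sat E (scons y (scons x (scons a r))) A.
  have h1 : sat E (scons a r) (All (Imp (Elem 0 1) (All (All (Imp
     (And (rename S A) (rename (up S) A)) (Eq 1 0)))))) <->
     forall x, E x a -> forall y y', R x y /\ R x y' -> y = y'.
    apply: sat_all => x; apply: sat_imp; first by [].
    apply: sat_all => y; apply: sat_all => y'; apply: sat_imp; last by [].
    by apply: sat_and; rewrite sat_rename; apply: sat_ext => -[].
  have h2 : sat E (scons a r) (Ex (All (Iff (Elem 0 1) (Ex (And (Elem 0 3)
     (rename (fun n => match n with 0 => 1 | 1 => 0 | m.+2 => m.+3 end) A)))))) <->
     exists b, forall y, E y b <-> exists x, E x a /\ R x y.
    apply: sat_ex => b; apply: sat_all => y; apply: sat_iff; first by [].
    apply: sat_ex => x; apply: sat_and; first by [].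
    by rewrite sat_rename; apply: sat_ext => -[|[]].
  by move/h1/family_repl/h2.
Qed.

Definition family_zf_model := ZfModel fempty family_zf.

End FamilyZF.

(** * The well-founded universe *)

(** Aczel's encoding: a node is the set of its immediate subtrees, repetitions allowed; [teq] is
    bisimilarity. *)
Inductive tree : Type := Sup (I : Type) (f : I -> tree).

Fixpoint teq (s t : tree) : Prop :=
  let: Sup J f := s in let: Sup K g := t in
  (forall i, exists j, teq (f i) (g j)) /\ (forall j, exists i, teq (f i) (g j)).

Lemma teq_refl t : teq t t.
Proof. by elim: t => I f IH /=; split=> i; exists i. Qed.

Lemma teq_sym s t : teq s t -> teq t s.
Proof.
elim: s t => I f IH [J g] /= [h1 h2]; split=> i.
  by have [j /IH] := h2 i; exists j.
by have [j /IH] := h1 i; exists j.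
Qed.

Lemma teq_trans s t u : teq s t -> teq t u -> teq s u.
Proof.
elim: s t u => I f IH [J g] [K h] /= [h1 h2] [h3 h4]; split=> i.
  by have [j e] := h1 i; have [k e'] := h3 j; exists k; apply: IH e e'.
by have [j e] := h4 i; have [k e'] := h2 j; exists k; apply: IH e' e.
Qed.

(** [epsilon] applied to equal predicates gives equal results, so with extensionality for functions
    and propositions every class of bisimilar trees gets one representative, and equality of sets is
    equality in Rocq. *)
Definition canon (t : tree) : tree :=
  epsilon (inhabits (Sup (fun i : False => match i with end))) (teq t).

Lemma teq_canon t : teq t (canon t).
Proof. by apply: epsilon_spec; exists t; apply: teq_refl. Qed.

Lemma canon_eq s t : teq s t <-> canon s = canon t.
Proof.
split=> [h|e]; last first.
  by apply: teq_trans (teq_canon s) _; rewrite e; apply/teq_sym/teq_canon.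
rewrite /canon; congr epsilon; apply: functional_extensionality => u.
apply: propositional_extensionality; split; last exact: teq_trans.
by apply: teq_trans; apply: teq_sym.
Qed.

Definition wset := {t : tree | canon t = t}.

Definition wclass (t : tree) : wset :=
  exist _ (canon t) (esym (iffLR (canon_eq _ _) (teq_canon t))).

Lemma wclass_eq s t : wclass s = wclass t <-> teq s t.
Proof.
split=> [[/canon_eq] //|/canon_eq e].
by apply: eq_sig_hprop => //= u; apply: proof_irrelevance.
Qed.

Lemma wclass_val (x : wset) : wclass (sval x) = x.
Proof. by case: x => t ct; apply: eq_sig_hprop => //= u; apply: proof_irrelevance. Qed.

Definition tidx (t : tree) : Type := let: Sup J _ := t in J.
Definition tsub (t : tree) : tidx t -> tree := let: Sup _ f := t in f.

Definition wmem (x y : wset) := exists i : tidx (sval y), x = wclass (tsub i).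

Lemma wmem_wclass x I (f : I -> tree) :
  wmem x (wclass (Sup f)) <-> exists i, x = wclass (f i).
Proof.
rewrite /wmem /=; have := teq_canon (Sup f); case: (canon _) => J g /= [h1 h2].
split=> -[i ->].
  by have [j e] := h2 i; exists j; apply/wclass_eq/teq_sym.
by have [j e] := h1 i; exists j; apply/wclass_eq.
Qed.

Lemma wmem_ext x y : (forall z, wmem z x <-> wmem z y) -> x = y.
Proof.
rewrite -(wclass_val x) -(wclass_val y).
case: (sval x) (sval y) => I f [J g] h; apply/wclass_eq; split=> i.
  have /h /wmem_wclass [j /wclass_eq e] : wmem (wclass (f i)) (wclass (Sup f)).
    by apply/wmem_wclass; exists i.
  by exists j.
have /h /wmem_wclass [j /wclass_eq e] : wmem (wclass (g i)) (wclass (Sup g)).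
  by apply/wmem_wclass; exists i.
by exists j; apply: teq_sym.
Qed.

Lemma wmem_wf (P : wset -> Prop) :
  (forall x, (forall y, wmem y x -> P y) -> P x) -> forall x, P x.
Proof.
move=> step x; rewrite -(wclass_val x); elim: (sval x) => I f IH.
by apply: step => y /wmem_wclass [i ->].
Qed.

Definition wfam (I : Type) (g : I -> wset) : wset := wclass (Sup (fun i => sval (g i))).

Lemma wmem_fam I (g : I -> wset) z : wmem z (wfam g) <-> exists i, z = g i.
Proof.
by rewrite wmem_wclass; split=> -[i ->]; exists i; rewrite wclass_val.
Qed.

(* Membership after the sets have been permuted (Rieger-Bernays). *)
Definition perm_family (f g : wset -> wset) (fg : cancel f g) (gf : cancel g f) :
  family_model.
Proof.
(* A set with prescribed new elements is the [g]-image of the old set with those elements, because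
   [f] undoes [g]. *)
refine (@FamilyModel wset (fun x y => wmem x (f y)) (fun y => tidx (sval (f y)))
  (fun y i => wclass (tsub i)) (fun I h => g (wfam h)) _ _ _).
- by [].
- by move=> I h z; rewrite gf wmem_fam.
- by move=> x y h; apply: (can_inj fg); apply: wmem_ext.
Defined.

(** * The five models *)

Section Loops.
Variable M : zf_model.
Implicit Types x y z o : M.

(** The class of all sets other than [o] satisfies the closure condition: a path of two steps from
    [o] can only lead back to [o]. So I does not win [o], and II does not either, as that would
    require I to win the element [o]. *)
Lemma quine_not_Wi o : (forall z, z ∊ o <-> z = o) -> ~ Wi o.
Proof.
move=> ho; have [||h1 h2] := @win_closed M o (fun z => z <> o); first by dfn.
  move=> z [u [uz hu]] ez; subst z; have /ho eu := uz; subst u.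
  by apply: (hu o uz).
by case=> [/h1 //|/h2 /(_ o)]; apply=> //; apply/ho.
Qed.

Lemma loop_not_Vi x : x ∊ x -> ~ Vi x.
Proof.
move=> xx vx; have [|m [/in_sing -> no]] := @Vi_minimal M x (upr x x) _ vx.
  exact/in_sing.
by apply: no; exists x; split=> //; apply/in_sing.
Qed.

Lemma loop_not_reg (K : M -> Prop) x : x ∊ x -> K x -> K (upr x x) -> ~ reg_in K.
Proof.
move=> xx Kx Ky reg; have [//||m [_ [/in_sing -> no]]] := reg (upr x x).
  by exists x; split=> //; apply/in_sing.
by apply: no; exists x; split=> //; split=> //; apply/in_sing.
Qed.

Lemma HWi_of_trans t x : trans t -> x ∊ t -> (forall z, z ∊ t -> Wi z) -> HWi x.
Proof.
move=> tt xt h; have [t' ht'] := tc_ex x; exists t'; split=> // z zt'.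
by apply: h; have [_ [_ m]] := ht'; apply: m zt'.
Qed.

End Loops.

Section PermModel.
Variables (f g : wset -> wset) (fg : cancel f g) (gf : cancel g f).
Variable L : wset -> Prop.
(** [L] collects the sets that may gain elements. Outside it the new elements are old ones, so
    induction along the old membership proves facts about the new one. *)
Hypothesis offL : forall y z, ~ L y -> wmem z (f y) -> wmem z y.
Let M := family_zf_model (perm_family fg gf).

Lemma perm_ind (P : M -> Prop) : (forall y, L y -> P y) ->
  (forall y : M, (forall z, z ∊ y -> P z) -> P y) -> forall y, P y.
Proof.
move=> hL step; apply: (@wmem_wf P) => y IH.
case: (classic (L y)) => [/hL //|nL]; apply: step => z zy.
by apply: IH; apply: offL zy.
Qed.

(** On [K] new membership is contained in the old, so descending inside [K] from any element of [y]
    stops at a minimal one. *)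
Lemma perm_reg (K : M -> Prop) : (forall y, L y -> ~ K y) -> reg_in K.
Proof.
move=> hL y _ [z [Kz zy]]; move: z Kz zy.
apply: (@wmem_wf (fun z : M => K z -> z ∊ y -> _)) => z IH Kz zy.
case: (classic (exists w, K w /\ w ∊ y /\ w ∊ z)) => [[w [Kw [wy wz]]]|no]; last by exists z.
apply: (IH w) => //; apply: offL wz => /hL; exact.
Qed.

Lemma perm_HWi_Vi : (forall y : M, L y -> ~ HWi y) -> coext (@HWi M) (@Vi M).
Proof.
move=> hL x; split; last exact: Vi_HWi.
move: x; apply: perm_ind => [y /hL //|y IH hy].
by apply: Vi_closed => z zy; apply: IH => //; apply: HWi_in hy zy.
Qed.

Lemma perm_Wi : (forall y : M, L y -> Wi y) -> forall y : M, Wi y.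
Proof. by move=> hL; apply: perm_ind => // y; apply: Wi_closed. Qed.

End PermModel.

(** * Transpositions of sets and the small sets they move *)

Definition swap (a b x : wset) : wset :=
  if excluded_middle_informative (x = a) then b
  else if excluded_middle_informative (x = b) then a else x.

Lemma swap_l a b : swap a b a = b.
Proof. by rewrite /swap; case: excluded_middle_informative. Qed.

Lemma swap_r a b : swap a b b = a.
Proof.
rewrite /swap; case: excluded_middle_informative => n //=.
by case: excluded_middle_informative.
Qed.

Lemma swap_other a b x : x <> a -> x <> b -> swap a b x = x.
Proof. by rewrite /swap; do 2!case: excluded_middle_informative. Qed.

Lemma swapK a b : cancel (swap a b) (swap a b).
Proof.
move=> x; case: (classic (x = a)) => [->|na]; first by rewrite swap_l swap_r.
case: (classic (x = b)) => [->|nb]; first by rewrite swap_r swap_l.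
by rewrite !swap_other.
Qed.

Definition swap2 a b c d x := swap a b (swap c d x).

Lemma swap2K a b c d : cancel (swap2 a b c d) (swap2 c d a b).
Proof. by move=> x; rewrite /swap2 !swapK. Qed.

Definition w0 : wset := wfam (fun i : False => match i with end).
Definition wpair (a b : wset) : wset := wfam (fun i : bool => if i then a else b).

Lemma in_w0 z : ~ wmem z w0. Proof. by move=> /wmem_fam [[]]. Qed.

Lemma in_wpair a b z : wmem z (wpair a b) <-> z = a \/ z = b.
Proof. by rewrite wmem_fam; split=> [[[] ->]|[->|->]]; [left|right|exists true|exists false]. Qed.

Lemma in_wsing a z : wmem z (wpair a a) <-> z = a.
Proof. rewrite in_wpair; tauto. Qed.

Definition w1 := wpair w0 w0.
Definition w2 := wpair w0 w1.
Definition w3 : wset :=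
  wfam (fun i : option bool => match i with None => w0 | Some true => w1 | _ => w2 end).

Lemma in_w3 z : wmem z w3 <-> z = w0 \/ z = w1 \/ z = w2.
Proof.
rewrite wmem_fam; split=> [[[[]|] ->]|[->|[->|->]]]; try tauto.
- by exists None.
- by exists (Some true).
- by exists (Some false).
Qed.

Lemma w01 : w0 <> w1.
Proof. by move=> e; apply: (@in_w0 w0); rewrite {2}e; apply/in_wsing. Qed.

Lemma wmem_irr x : ~ wmem x x.
Proof. by move: x; apply: wmem_wf => x h xx; apply: (h x xx). Qed.

Lemma wmem_neq x y : wmem x y -> x <> y.
Proof. by move=> h e; move: h; rewrite e; apply: wmem_irr. Qed.

Lemma consistent_of_sat (M : zf_model) A :
  (forall r : nat -> M, sat (@mem M) r A) -> consistent (extend ZFminus A).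
Proof.
move=> h; apply: (@consistent_of_model _ M (@mem M) (fun=> zf_point M)).
by move=> B [/zf_sat|->].
Qed.

Lemma case1_consistent : consistent (extend ZFminus case1).
Proof.
pose idK : cancel (@id wset) id := fun x => erefl.
apply: (@consistent_of_sat (family_zf_model (perm_family idK idK))) => r.
have [h _] := five_cases r; apply: h.
by apply: (perm_reg (L := fun=> False)).
Qed.

(* 0 becomes the only set equal to its own singleton, 1 the empty set. *)
Lemma case2_consistent : consistent (extend ZFminus case2).
Proof.
set f := swap w0 w1; pose fK : cancel f f := @swapK w0 w1.
set M := family_zf_model (perm_family fK fK).
apply: (@consistent_of_sat M) => r; have [_ [h _]] := five_cases r.
have f0 : f w0 = w1 := swap_l _ _; have f1 : f w1 = w0 := swap_r _ _.
have offL y z : ~ y = w0 -> wmem z (f y) -> wmem z y.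
  move=> n0; case: (classic (y = w1)) => [->|n1]; first by rewrite f1 => /in_w0.
  by rewrite /f swap_other.
have q : ~ Wi (w0 : M).
  by apply: quine_not_Wi => z; rewrite /= f0 in_wsing.
apply: h.
- by move=> e; apply: q; apply/e.
- by apply: (perm_HWi_Vi offL) => y -> /HWi_Wi.
- by apply: (perm_reg offL) => y ->.
Qed.

(** [w0] becomes Ω, [w1] the empty set, and [w2], which receives the elements of [w3], becomes x =
    {Ω, ∅, x}. Player I wins x by moving to ∅, so {x} refutes regularity in W, while Ω keeps x out
    of HW. *)
Lemma case3_consistent : consistent (extend ZFminus case3).
Proof.
set f := swap2 w0 w1 w2 w3.
set M := family_zf_model (perm_family (@swap2K w0 w1 w2 w3) (@swap2K w2 w3 w0 w1)).
have n02 : w0 <> w2 by apply: wmem_neq; apply/in_wpair; left.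
have n12 : w1 <> w2 by apply: wmem_neq; apply/in_wpair; right.
have n03 : w0 <> w3 by apply: wmem_neq; apply/in_w3; left.
have n13 : w1 <> w3 by apply: wmem_neq; apply/in_w3; right; left.
have f0 : f w0 = w1 by rewrite /f /swap2 (swap_other n02 n03) swap_l.
have f1 : f w1 = w0 by rewrite /f /swap2 (swap_other n12 n13) swap_r.
have f2 : f w2 = w3 by rewrite /f /swap2 swap_l swap_other //; apply: nesym.
have f3 : f w3 = w2 by rewrite /f /swap2 swap_r swap_other //; apply: nesym.
have offL y z : ~ (y = w0 \/ y = w2) -> wmem z (f y) -> wmem z y.
  move=> n; case: (classic (y = w1)) => [->|n1]; first by rewrite f1 => /in_w0.
  case: (classic (y = w3)) => [->|n3].
    by rewrite f3 => /in_wpair h; apply/in_w3; tauto.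
  by rewrite /f /swap2 (@swap_other w2 w3) ?swap_other //; tauto.
apply: (@consistent_of_sat M) => r; have [_ [_ [h _]]] := five_cases r.
have q : ~ Wi (w0 : M) by apply: quine_not_Wi => z; rewrite /= -/f f0 in_wsing.
have e1 : (w1 : M) = e0 by apply/e0_eq => z; rewrite /= -/f f1; apply: in_w0.
have in2 z : (z : M) ∊ (w2 : M) <-> z = w0 \/ z = w1 \/ z = w2 by rewrite /= -/f f2 in_w3.
have W2 : Wi (w2 : M) by left; apply: Iw_e0_in; rewrite -e1; apply/in2; right; left.
apply: h.
- by move=> e; apply: q; apply/e.
- apply: (perm_HWi_Vi offL) => y [->|->] => [/HWi_Wi //|h].
  by apply: q; apply: HWi_Wi; apply: HWi_in h _; apply/in2; left.
- apply: (@loop_not_reg M _ w2) => //; first by apply/in2; right; right.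
  by apply: Wi_closed => z /in_sing ->.
Qed.

(** [w0] stays empty and [w1] receives the elements of [w2], that is, becomes x = {∅, x}. The set x
    is winning, and induction along the old membership makes all sets winning. *)
Lemma case4_consistent : consistent (extend ZFminus case4).
Proof.
set f := swap w1 w2; pose fK : cancel f f := @swapK w1 w2.
set M := family_zf_model (perm_family fK fK).
have n02 : w0 <> w2 by apply: wmem_neq; apply/in_wpair; left.
have f0 : f w0 = w0 by apply: swap_other => //; apply: w01.
have f1 : f w1 = w2 := swap_l _ _; have f2 : f w2 = w1 := swap_r _ _.
have offL y z : ~ y = w1 -> wmem z (f y) -> wmem z y.
  move=> n1; case: (classic (y = w2)) => [->|n2]; last by rewrite /f swap_other.
  by rewrite f2 => /in_wsing ->; apply/in_wpair; left.
apply: (@consistent_of_sat M) => r; have [_ [_ [_ [h _]]]] := five_cases r.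
have e0_ : (w0 : M) = e0 by apply/e0_eq => z; rewrite /= f0; apply: in_w0.
have in1 z : (z : M) ∊ (w1 : M) <-> z = w0 \/ z = w1 by rewrite /= f1 in_wpair.
apply: h; first by apply: (@loop_not_reg M _ w1) => //; apply/in1; right.
move=> x; split=> // _; apply: (perm_Wi offL) => y ->.
by left; apply: Iw_e0_in; rewrite -e0_; apply/in1; left.
Qed.

(** [w0] becomes Ω and [w1] the empty set; [c] receives the elements of [d] and becomes x = {∅, x}.
    The choice of [c] and [d] keeps them distinct from [w0] and [w1], so the two transpositions do
    not interfere. *)
Lemma case5_consistent : consistent (extend ZFminus case5).
Proof.
pose c := wpair w1 w1; pose d := wpair w1 c.
set f := swap2 w0 w1 c d.
set M := family_zf_model (perm_family (@swap2K w0 w1 c d) (@swap2K c d w0 w1)).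
have n0 a b : w0 <> wpair a b.
  by move=> e; apply: (@in_w0 a); rewrite e; apply/in_wpair; left.
have n1c : w1 <> c by apply: wmem_neq; apply/in_wsing.
have n1d : w1 <> d by apply: wmem_neq; apply/in_wpair; left.
have n0c : w0 <> c := n0 _ _; have n0d : w0 <> d := n0 _ _.
have f0 : f w0 = w1 by rewrite /f /swap2 (swap_other n0c n0d) swap_l.
have f1 : f w1 = w0 by rewrite /f /swap2 (swap_other n1c n1d) swap_r.
have fc : f c = d by rewrite /f /swap2 swap_l swap_other //; apply: nesym.
apply: (@consistent_of_sat M) => r; have [_ [_ [_ [_ h]]]] := five_cases r.
have q : ~ Wi (w0 : M) by apply: quine_not_Wi => z; rewrite /= -/f f0 in_wsing.
have e1 : (w1 : M) = e0 by apply/e0_eq => z; rewrite /= -/f f1; apply: in_w0.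
have inc z : (z : M) ∊ (c : M) <-> z = w1 \/ z = c by rewrite /= -/f fc in_wpair.
apply: h => [e|e]; first by apply: q; apply/e.
apply: (@loop_not_Vi M c); first by apply/inc; right.
(* [c] is transitive and contains itself, so it is its own witness for belonging to HW. *)
apply/e; apply: (@HWi_of_trans M c); last 1 first.
- move=> z /inc [->|->]; first by right; rewrite e1; apply: IIw_e0.
  by left; apply: Iw_e0_in; rewrite -e1; apply/inc; left.
- move=> y /inc [->|->] // z; rewrite e1 => /in_e0 //.
- by apply/inc; right.
Qed.

Theorem theorem4 :
  proves ZFminus (exactly_one [:: case1; case2; case3; case4; case5]) /\
  (consistent (extend ZFminus case1) /\
   consistent (extend ZFminus case2) /\
   consistent (extend ZFminus case3) /\
   consistent (extend ZFminus case4) /\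
   consistent (extend ZFminus case5)).
Proof.
split; first exact: ZFminus_exactly_one.
split; first exact: case1_consistent.
split; first exact: case2_consistent.
split; first exact: case3_consistent.
split; [exact: case4_consistent|exact: case5_consistent].
Qed.
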